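(* Let $n\ge 1$, let $L_1,\dots,L_n\in\mathbb{R}\setminus\{0\}$, and let $G=\mathbb{R}^{2n+1}$ be the Carnot group with the horizontal vector fields $X_1,\dots,X_{2n}$ and the inner product described in the context. Let $$\rho(x_1,\dots,x_{2n},t)=\Bigg(\bigg(\sum_{i=1}^{n}2|L_i|x_i^2+\sum_{i=n+1}^{2n}2|L_{i-n}|x_i^2\bigg)^2+16t^2\Bigg)^{\frac14}.$$ Let $\mathcal{Q}=2n+2$. For $1<p<\infty$ let $\omega_p=\int_{\{\rho<1\}}\|\nabla_0\rho\|^p$ and define $$C_p=\begin{cases}\dfrac{p-1}{p-\mathcal{Q}}(\mathcal{Q}\omega_p)^{-\frac{1}{p-1}}, & p\neq\mathcal{Q},\\[2mm] (\mathcal{Q}\omega_p)^{-\frac{1}{p-1}}, & p=\mathcal{Q},\end{cases}\qquad \Gamma_p=\begin{cases}C_p\,\rho^{\frac{p-\mathcal{Q}}{p-1}}, & p\neq\mathcal{Q},\\[2mm] C_p\log\rho, & p=\mathcal{Q}.\end{cases}$$ Then for every $1<p<\infty$ the function $\Gamma_p$ is the fundamental solution to the $p$-Laplace equation $\Delta_p u=0$ on $G$ with singularity at the identity element $e=0$. Moreover, $\Delta_\infty\rho=0$ on $G\setminus\{e\}$.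
   Context: Setting. On $\mathbb{R}^{2n+1}$ with coordinates $(x_1,\dots,x_{2n},t)$ let $T=\frac{\partial}{\partial t}$ and $$X_j=\frac{\partial}{\partial x_j}-L_j x_{j+n}\frac{\partial}{\partial t}\ (1\le j\le n),\qquad X_j=\frac{\partial}{\partial x_j}+L_{j-n}x_{j-n}\frac{\partial}{\partial t}\ (n+1\le j\le 2n).$$ These span a stratified Lie algebra $g=V_1\oplus V_2$, $V_1=\operatorname{span}\{X_1,\dots,X_{2n}\}$, $V_2=\operatorname{span}\{T\}$, whose associated step-two Carnot group $G$ is $\mathbb{R}^{2n+1}$ in exponential coordinates, $\exp(\sum_j x_jX_j+tT)=(x_1,\dots,x_{2n},t)$, with identity element $e=0$. Integrals are with respect to Lebesgue measure on $\mathbb{R}^{2n+1}$ (a Haar measure on $G$). The Lie algebra is endowed with the inner product $\langle\cdot,\cdot\rangle$ for which $X_1,\dots,X_{2n},T$ are mutually orthogonal, $\langle X_j,X_j\rangle=2|L_j|$ for $1\le j\le n$, $\langle X_j,X_j\rangle=2|L_{j-n}|$ for $n+1\le j\le 2n$, and $\langle T,T\rangle=1$. Put $\ell_j=|L_j|$ for $1\le j\le n$ and $\ell_j=|L_{j-n}|$ for $n+1\le j\le 2n$, so that $Y_j=X_j/\sqrt{2\ell_j}$, $1\le j\le 2n$, is an orthonormal basis of $V_1$. For a smooth function $f$, the horizontal gradient is $\nabla_0 f=(Y_1f,\dots,Y_{2n}f)$ (components in the orthonormal frame), so $\|\nabla_0 f\|^2=\sum_{j=1}^{2n}\frac{1}{2\ell_j}(X_jf)^2$.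 The $p$-Laplacian is $\Delta_p f=\sum_{j=1}^{2n}Y_j\big(\|\nabla_0 f\|^{p-2}Y_jf\big)$, and the infinite Laplacian is $$\Delta_\infty f=\sum_{i,j=1}^{2n}(Y_if)(Y_jf)(Y_iY_jf)=\sum_{i,j=1}^{2n}\frac{1}{4\ell_i\ell_j}(X_iX_jf)(X_if)(X_jf).$$ A function $\Gamma$, smooth on $G\setminus\{e\}$, is a fundamental solution to the $p$-Laplace equation with singularity at $e$ if $\Delta_p\Gamma=\delta_e$ in the weak sense, that is, $\|\nabla_0\Gamma\|^{p-1}$ (computed classically on $G\setminus\{e\}$) is locally integrable on $G$ and $$\int_G\|\nabla_0\Gamma\|^{p-2}\sum_{j=1}^{2n}(Y_j\Gamma)(Y_j\varphi)=-\varphi(e)\quad\text{for all }\varphi\in C_c^\infty(G).$$ *)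

(* Defs.v *)
From HB Require Import structures.
From mathcomp Require Import all_boot all_order all_algebra.
From mathcomp Require Import all_classical all_reals all_analysis.

Set Implicit Arguments.
Unset Strict Implicit.
Unset Printing Implicit Defensive.

Import Order.TTheory GRing.Theory Num.Theory.
Import numFieldNormedType.Exports.

Local Open Scope classical_set_scope.
Local Open Scope ring_scope.

Section rV_measurable.
Context {R : realType} (n : nat).

Let coords : 'I_n -> 'rV[R]_n -> R := fun i x => x ord0 i.

Let rV_set0 : g_sigma_preimage coords set0.
Proof. exact: sigma_algebra0. Qed.

Let rV_setC A : g_sigma_preimage coords A -> g_sigma_preimage coords (~` A).
Proof. exact: sigma_algebraC. Qed.

Let rV_bigcup (F : (set 'rV[R]_n)^nat) :
  (forall i, g_sigma_preimage coords (F i)) ->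
  g_sigma_preimage coords (\bigcup_i (F i)).
Proof. exact: sigma_algebra_bigcup. Qed.

(* The Borel sigma-algebra of R^n, generated by the coordinate functions (the
   library has the analogous instance for n.-tuples, which carry no topology). *)
HB.instance Definition _ :=
  @isMeasurable.Build (measure_tuple_display default_measure_display)
    'rV[R]_n (g_sigma_preimage coords) rV_set0 rV_setC rV_bigcup.

End rV_measurable.

Section rV_lebesgue.
Context {R : realType}.
Local Notation lambda := (@lebesgue_measure R).

Lemma measurable_coord n (i : 'I_n) :
  measurable_fun [set: 'rV[R]_n] (fun x : 'rV[R]_n => x ord0 i).
Proof.
move=> _ Y mY; rewrite setTI; apply: sub_sigma_algebra => /=.
rewrite -bigcup_seq/=; exists i => /=; first by rewrite mem_index_enum.
by exists Y => //; rewrite setTI.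
Qed.

Lemma measurable_fun_coordP d (T : measurableType d) n (f : T -> 'rV[R]_n) :
  (forall i, measurable_fun [set: T] (fun x => f x ord0 i)) ->
  measurable_fun [set: T] f.
Proof.
move=> mf _ A mA; rewrite setTI.
apply: (mA [set B | measurable (f @^-1` B)]); split.
  split => /=.
  - by rewrite preimage_set0.
  - by move=> B mB; rewrite setTD -preimage_setC; exact: measurableC.
  - by move=> F mF; rewrite preimage_bigcup; exact: bigcupT_measurable.
rewrite -bigcup_seq/= => B [i _ [Y mY <-]] /=.
by rewrite setTI -[X in measurable X]setTI; exact: mf.
Qed.

Definition rV_cons n (z : 'rV[R]_n * R) : 'rV[R]_n.+1 := row_mx z.2%:M z.1.

Lemma rV_cons0 n (z : 'rV[R]_n * R) : rV_cons z ord0 ord0 = z.2.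
Proof.
rewrite (_ : rV_cons z ord0 ord0 =
  row_mx z.2%:M z.1 ord0 (lshift n (ord0 : 'I_1))).
  by rewrite row_mxEl mxE.
by congr (row_mx _ _ _ _); exact/val_inj.
Qed.

Lemma rV_consS n (z : 'rV[R]_n * R) (i : 'I_n) :
  rV_cons z ord0 (lift ord0 i) = z.1 ord0 i.
Proof.
rewrite (_ : rV_cons z ord0 (lift ord0 i) =
  row_mx z.2%:M z.1 ord0 (rshift 1 i)).
  by rewrite row_mxEr.
by congr (row_mx _ _ _ _); exact/val_inj.
Qed.

Lemma measurable_rV_cons n :
  measurable_fun [set: 'rV[R]_n * measurableTypeR R] (@rV_cons n).
Proof.
apply: measurable_fun_coordP => i; case: (unliftP ord0 i) => [j|] ->.
- under eq_fun do rewrite rV_consS.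
  exact: (measurableT_comp (measurable_coord j)).
- by under eq_fun do rewrite rV_cons0; exact: measurable_snd.
Qed.

Section lebesgue_step.
Context n (m : {measure set 'rV[R]_n -> \bar R}).

Definition lebesgue_step : set 'rV[R]_n.+1 -> \bar R :=
  pushforward (m \x lambda)%E (@rV_cons n).

Let lebesgue_step0 : lebesgue_step set0 = 0%E.
Proof. by rewrite /lebesgue_step /pushforward preimage_set0 measure0. Qed.

Let lebesgue_step_ge0 A : (0 <= lebesgue_step A)%E.
Proof. by rewrite /lebesgue_step /pushforward measure_ge0. Qed.

Let lebesgue_step_sigma_additive : semi_sigma_additive lebesgue_step.
Proof.
have mc := @measurable_rV_cons n.
move=> F mF tF mUF; rewrite /lebesgue_step /pushforward preimage_bigcup.
apply: measure_semi_sigma_additive.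
- by move=> k; rewrite -[X in measurable X]setTI; exact: mc.
- apply/trivIsetP => /= i j _ _ ij; rewrite -preimage_setI.
  by move/trivIsetP : tF => /(_ _ _ _ _ ij) ->//; rewrite preimage_set0.
- by rewrite -preimage_bigcup -[X in measurable X]setTI; exact: mc.
Qed.

HB.instance Definition _ := isMeasure.Build _ _ _ lebesgue_step
  lebesgue_step0 lebesgue_step_ge0 lebesgue_step_sigma_additive.

End lebesgue_step.

(* Lebesgue measure on R^n as an n-fold product; lebesgue_rV_box below pins it
   down by its values on boxes. *)
Fixpoint lebesgue_rV_rec n : {measure set 'rV[R]_n -> \bar R} :=
  if n is m.+1 then lebesgue_step (lebesgue_rV_rec m)
  else \d_(0 : 'rV[R]_0).

Definition lebesgue_rV n : set 'rV[R]_n -> \bar R := lebesgue_rV_rec n.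

HB.instance Definition _ n := Measure.on (@lebesgue_rV n).

Lemma measurable_box n (A : 'I_n -> set R) : (forall i, measurable (A i)) ->
  measurable [set x : 'rV[R]_n | forall i, A i (x ord0 i)].
Proof.
move=> mA; rewrite (_ : [set _ | _] =
    \bigcap_(i in [set: 'I_n]) ((fun x : 'rV[R]_n => x ord0 i) @^-1` A i)).
  apply: fin_bigcap_measurable => // i _.
  by rewrite -[X in measurable X]setTI; exact: measurable_coord.
by apply/seteqP; split => x /= Ax i => [_|]; exact: Ax.
Qed.

Lemma lebesgue_rV_box n (A : 'I_n -> set R) : (forall i, measurable (A i)) ->
  lebesgue_rV [set x : 'rV[R]_n | forall i, A i (x ord0 i)] =
  (\prod_(i < n) lambda (A i))%E.
Proof.
elim: n A => [|n ih] A mA.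
  rewrite big_ord0 /lebesgue_rV /= diracE mem_set//= => -[] //.
rewrite big_ord_recl -ih; last by move=> i; exact: mA.
have mB : measurable [set x : 'rV[R]_n | forall i, A (lift ord0 i) (x ord0 i)].
  by apply: (@measurable_box _ (fun i => A (lift ord0 i))) => i; exact: mA.
have mA0 : measurable (A ord0 : set (measurableTypeR R)) by exact: mA.
rewrite muleC -product_measure1E//.
congr ((_ \x _)%E _); apply/seteqP; split => -[x t] /=.
  move=> Ax; split=> [i|]; last by have := Ax ord0; rewrite rV_cons0.
  by have := Ax (lift ord0 i); rewrite rV_consS.
move=> [Ax At] i; case: (unliftP ord0 i) => [j|] ->.
  by rewrite rV_consS; exact: Ax.
by rewrite rV_cons0.
Qed.

Let sigma_finite_lebesgue_rV n : sigma_finite setT (@lebesgue_rV n).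
Proof.
exists (fun k => [set x : 'rV[R]_n |
    forall i, `[- (k%:R : R), k%:R]%classic (x ord0 i)]).
  apply/esym/seteqP; split => // x _.
  exists (Num.truncn (\sum_i `|x ord0 i|)).+1 => //= i.
  rewrite in_itv /= -ler_norml ltW//.
  rewrite (le_lt_trans _ (truncnS_gt _))//.
  by rewrite (bigD1 i)//= lerDl sumr_ge0.
move=> k; split.
  by apply: (@measurable_box _ (fun=> `[- (k%:R : R), k%:R]%classic)).
rewrite (lebesgue_rV_box (A := fun=> `[- (k%:R : R), k%:R]%classic))//.
rewrite ltey_eq prode_fin_num// => i _.
by rewrite lebesgue_measure_itv/=; case: ifP.
Qed.

HB.instance Definition _ n := Measure_isSigmaFinite.Build _ _ _
  (@lebesgue_rV n) (@sigma_finite_lebesgue_rV n).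

End rV_lebesgue.

Section smooth.
Context {R : realType} {m : nat}.
Implicit Types (f : 'rV[R]_m -> R) (U : set 'rV[R]_m).

Definition partial (j : 'I_m) f : 'rV[R]_m -> R :=
  fun x => 'D_(delta_mx ord0 j) f x.

Definition iter_partial (s : seq 'I_m) f : 'rV[R]_m -> R := foldr partial f s.

(* C^infinity on the open set U: all iterated partial derivatives exist and are
   continuous at every point of U. *)
Definition smooth_on U f := forall x, U x -> forall s : seq 'I_m,
  {for x, continuous (iter_partial s f)} /\
  forall j, derivable (iter_partial s f) x (delta_mx ord0 j).

Definition test_function f :=
  smooth_on setT f /\ compact (closure [set x | f x != 0]).

Definition locally_integrable_rV f := forall K : set 'rV[R]_m, compact K ->
  (@lebesgue_rV R m).-integrable K (EFin \o f).

End smooth.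

Section carnot.
Context {R : realType} {n : nat}.
Variable L : 'I_n -> R.

(* Exponential coordinates (x_1, ..., x_2n, t); the identity element is 0. *)
Local Notation G := 'rV[R]_(n + n + 1).

Local Notation mu := (@lebesgue_rV R (n + n + 1)).

Definition xidx (j : 'I_(n + n)) : 'I_(n + n + 1) := lshift 1 j.

Definition tidx : 'I_(n + n + 1) := rshift (n + n) ord0.

Definition coordx (x : G) (j : 'I_(n + n)) : R := x ord0 (xidx j).

Definition coordt (x : G) : R := x ord0 tidx.

Definition ell (j : 'I_(n + n)) : R :=
  match fintype.split j with inl i => `|L i| | inr i => `|L i| end.

Definition vfX (j : 'I_(n + n)) (f : G -> R) : G -> R := fun x =>
  match fintype.split j with
  | inl i =>
      partial (xidx j) f x - L i * coordx x (rshift n i) * partial tidx f x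
  | inr i =>
      partial (xidx j) f x + L i * coordx x (lshift n i) * partial tidx f x
  end.

(* The orthonormal frame of the first layer: <X_j, X_j> = 2 ell_j. *)
Definition vfY (j : 'I_(n + n)) (f : G -> R) : G -> R := fun x =>
  (Num.sqrt (2 * ell j))^-1 * vfX j f x.

(* The Euclidean norm of (Y_1 f, ..., Y_2n f); the norm of 'rV in the library
   is the sup norm. *)
Definition hgrad_norm (f : G -> R) : G -> R := fun x =>
  Num.sqrt (\sum_j vfY j f x ^+ 2).

Definition inf_laplacian (f : G -> R) : G -> R := fun x =>
  \sum_i \sum_j vfY i f x * vfY j f x * vfY i (vfY j f) x.

(* The point 0, where the derivatives of u are meaningless, is a null set.
   Where the horizontal gradient of u vanishes, the integrand is 0 whatever the
   value of 0 `^ (p - 2). *)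
Definition is_fundamental_solution (p : R) (u : G -> R) :=
  [/\ smooth_on (~` [set 0]) u,
      locally_integrable_rV (fun x => hgrad_norm u x `^ (p - 1)) &
      forall phi : G -> R, test_function phi ->
        (\int[mu]_x (hgrad_norm u x `^ (p - 2) *
                     \sum_j vfY j u x * vfY j phi x)%:E = (- phi 0)%:E)%E].

Definition rho (x : G) : R :=
  ((\sum_(i < n) 2 * `|L i| * coordx x (lshift n i) ^+ 2 +
    \sum_(i < n) 2 * `|L i| * coordx x (rshift n i) ^+ 2) ^+ 2 +
   16 * coordt x ^+ 2) `^ (4^-1).

Definition homdim : R := (2 * n + 2)%:R.

Definition omega (p : R) : R :=
  \int[mu]_(x in [set x : G | rho x < 1]) (hgrad_norm rho x `^ p).

Definition Cp (p : R) : R :=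
  if p == homdim then (homdim * omega p) `^ (- (p - 1)^-1)
  else (p - 1) / (p - homdim) * (homdim * omega p) `^ (- (p - 1)^-1).

Definition Gamma (p : R) : G -> R := fun x =>
  if p == homdim then Cp p * ln (rho x)
  else Cp p * rho x `^ ((p - homdim) / (p - 1)).

End carnot.

(* Main.v *)
Require Import Defs.
From HB Require Import structures.
From mathcomp Require Import all_boot all_order all_algebra.
From mathcomp Require Import all_classical all_reals all_analysis.
From mathcomp Require Import fingroup perm measurable_realfun.
From mathcomp Require Import ring lra.

Set Implicit Arguments.
Unset Strict Implicit.
Unset Printing Implicit Defensive.

Import Order.TTheory GRing.Theory Num.Theory.
Import numFieldNormedType.Exports.

Local Open Scope classical_set_scope.
Local Open Scope ring_scope.

(** Let d be the sum of 2 ell_j x_j^2 over the horizontal coordinates, so that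
    rho^4 = d^2 + 16 t^2. The proof rests on an identity valid for every function
    f off the origin ([hpair_gauge4], [hpair_rho]):
      sum_j (Y_j rho) (Y_j f) = rho^(-3) (d E f + 4 t T f),
    where E is the generator of the dilations (x, t) -> (s x, s^2 t) and T is a
    sum of infinitesimal rotations, with signs, of the planes (x_i, x_{i+n}).
    Rotations preserve d and t, while E acts on homogeneous functions by their
    degree. Hence |grad rho|^2 = d / rho^2 ([hgrad_rho2]), and the derivative of
    d / rho^2 along grad rho is 0, which says that rho is infinity-harmonic
    ([inf_laplacian_rho]).

    The function Gamma depends on rho only, and its constant is such that
      |grad Gamma|^(p-2) grad Gamma
        = (Q omega)^(-1) rho^(1-Q) |grad rho|^(p-2) grad rho.
    Pairing this field with the gradient of a test function phi, the identity
    above gives a radial term and angular terms ([weak_integrand]).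

    The radial term is (Q omega)^(-1) |grad rho|^p rho^(-Q) E phi. Polar
    coordinates for the dilations ([ge0_polar], [polar]), a consequence of
    Tonelli's theorem and of the Jacobian s^Q, express
      int f rho^(-Q) / Q  as  int_(rho < 1) int_(s > 0) f (dil s x) / s.
    Here |grad rho|^p is constant along orbits and E phi (dil s x) / s is the
    derivative of phi (dil s x) with respect to s, whose integral over s > 0 is
    - phi 0 ([radial_integral]). What remains is the integral of |grad rho|^p
    over the unit ball, which is omega, and the radial term contributes - phi 0
    ([T1_integral]).

    Each angular term is a function of d and t times the derivative of phi under
    a plane rotation. Averaging over all rotations of that plane, which preserve
    Lebesgue measure as products of shears, replaces that derivative by its
    integral over a full turn, which is 0 ([integral_rotation_eq0]).

    All these integrals converge because the integrands are bounded by multiples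
    of rho^(1-Q) on a ball, and polar coordinates show that this function is
    integrable there ([integrable_le_ker]); the same bound gives the local
    integrability of |grad Gamma|^(p-1). Smoothness off the origin holds because
    the partial derivatives of rho and Gamma remain in a class of explicit
    expressions ([elem_smooth]). *)

(** * Borel sets of R^n and uniqueness of Lebesgue measure *)

Section borel.
Context {R : realType}.

Lemma ball_rVE m (x : 'rV[R]_m) e : 0 < e ->
  ball x e = [set y | forall i, `|x ord0 i - y ord0 i| < e].
Proof.
move=> e0; apply/seteqP; split => y /=.
  by move=> [_ xy] i; exact: xy.
move=> xy; split => // i j; rewrite (ord1 i); exact: xy.
Qed.

Lemma measurable_ball_rV m (x : 'rV[R]_m) e : measurable (ball x e).
Proof.
have [e0|e0] := ltP 0 e; last first.
  by rewrite (_ : ball x e = set0)// -subset0 => y [+ _]; rewrite ltNge e0.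
rewrite ball_rVE//.
rewrite [X in measurable X](_ : _ =
    [set y : 'rV[R]_m | forall i, `]x ord0 i - e, x ord0 i + e[%classic (y ord0 i)]).
  by apply: (@measurable_box _ _ (fun i => `]x ord0 i - e, x ord0 i + e[%classic)).
apply/seteqP; split => y /= xy i; have := xy i;
  rewrite /= in_itv /= ltr_norml => /andP[? ?]; apply/andP; split; lra.
Qed.

(** The sigma-algebra is generated by the coordinates alone, so openness has to
    be exhausted by countably many boxes: the rational balls inside U. *)
Lemma open_measurable_rV m (U : set 'rV[R]_m) : open U -> measurable U.
Proof.
move=> oU.
pose F (i : 'rV[rat]_m * nat) : set 'rV[R]_m :=
  if `[< ball (map_mx ratr i.1 : 'rV[R]_m) i.2.+1%:R^-1 `<=` U >]
  then ball (map_mx ratr i.1 : 'rV[R]_m) i.2.+1%:R^-1 else set0.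
rewrite (_ : U = \bigcup_i F i).
  apply: countable_bigcupT_measurable => [|i]; first exact: countableP.
  rewrite /F.
  by case: ifP => // _; exact: measurable_ball_rV.
apply/seteqP; split => [x Ux|x [i _]]; last first.
  by rewrite /F; case: ifPn => // /asboolP; exact.
have /nbhs_ballP[e /= e0 exU] : nbhs x U by exact: open_nbhs_nbhs.
have [k ke] : exists k : nat, k.+1%:R^-1 < e / 2.
  exists (Num.truncn (e / 2)^-1); rewrite invf_plt ?posrE ?divr_gt0//.
  by rewrite truncnS_gt.
have k0 : 0 < k.+1%:R^-1 :> R by rewrite invr_gt0.
have /choice[q qx] i : exists q : rat, `|ratr q - x ord0 i| < k.+1%:R^-1.
  have /rat_in_itvoo[q] : x ord0 i - k.+1%:R^-1 < x ord0 i + k.+1%:R^-1.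
    by rewrite ltrD2l gtrN.
  rewrite in_itv /= => /andP[? ?]; exists q.
  by rewrite ltr_norml ltrBrDl [X in _ && X]ltrBlDl; apply/andP; split.
have Bx : ball (map_mx ratr (\row_i q i) : 'rV[R]_m) k.+1%:R^-1 x.
  by rewrite ball_rVE// => i /=; rewrite !mxE.
exists (\row_i q i, k) => //=; rewrite /F /= ifT//.
apply/asboolP => y yq; apply: exU.
apply: (@le_ball _ _ _ (k.+1%:R^-1 + k.+1%:R^-1)).
  by rewrite [leRHS]splitr lerD // ltW.
by apply: ball_triangle yq; exact: ball_sym.
Qed.

Lemma closed_measurable_rV m (U : set 'rV[R]_m) : closed U -> measurable U.
Proof.
move=> cU; rewrite -[U]setCK; apply: measurableC.
by apply: open_measurable_rV; exact: closed_openC.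
Qed.

Lemma compact_measurable_rV m (U : set 'rV[R]_m) : compact U -> measurable U.
Proof.
move=> cU; apply: closed_measurable_rV.
exact: compact_closed (@norm_hausdorff _ _) cU.
Qed.

Lemma continuous_measurable_rV m (f : 'rV[R]_m -> R) :
  continuous f -> measurable_fun [set: 'rV[R]_m] f.
Proof.
move=> cf; apply: (measurability _ (measurable_realfun.RGenOpens.measurableE R)).
move=> _ [_ [a [b ->] <-]]; rewrite setTI; apply: open_measurable_rV.
by move/continuousP : cf; apply; exact: interval_open.
Qed.

End borel.

Section lebesgue_unique.
Context {R : realType}.
Local Notation lambda := (@lebesgue_measure R).

Definition box n (A : 'I_n -> set R) : set 'rV[R]_n :=
  [set x | forall i, A i (x ord0 i)].

(** Boxes form a generating pi-system containing an exhaustion by sets of finite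
    measure. Every change of variables below is reduced to this fact. *)
Lemma lebesgue_rV_unique n (m : {measure set 'rV[R]_n -> \bar R}) :
  (forall A : 'I_n -> set R, (forall i, measurable (A i)) ->
    m (box A) = (\prod_(i < n) lambda (A i))%E) ->
  forall E, measurable E -> m E = lebesgue_rV E.
Proof.
move=> mbox.
pose G := [set B : set 'rV[R]_n |
  exists2 A : 'I_n -> set R, (forall i, measurable (A i)) & B = box A].
pose g k : set 'rV[R]_n := box (fun=> `[- (k%:R : R), k%:R]%classic).
apply: (measure_unique G g).
- apply/seteqP; split.
    apply: smallest_sub; first exact: smallest_sigma_algebra.
    rewrite -bigcup_seq => B [i _ [Y mY <-]]; apply: sub_sigma_algebra.
    exists (fun j => if j == i then Y else setT) => [j|]; first by case: ifP.
    apply/seteqP; split => x /=.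
      by move=> [_ Yx] j; case: eqP => [->|].
    by move=> /(_ i); rewrite eqxx; split.
  apply: smallest_sub; first exact: (@sigma_algebra_measurable _ 'rV[R]_n).
  by move=> B [A mA ->]; exact: measurable_box.
- move=> B C [A mA ->] [A' mA' ->]; exists (fun i => A i `&` A' i).
    by move=> i; exact: measurableI.
  apply/seteqP; split => x /=; first by move=> [? ?] i; split.
  by move=> H; split=> i; have [] := H i.
- by move=> k; exists (fun=> `[- (k%:R : R), k%:R]%classic).
- apply/seteqP; split => // x _.
  exists (Num.truncn (\sum_i `|x ord0 i|)).+1 => //= i.
  rewrite /mkset in_itv /= -ler_norml ltW//.
  rewrite (le_lt_trans _ (truncnS_gt _))//.
  by rewrite (bigD1 i)//= lerDl sumr_ge0.
- by move=> B [A mA ->]; rewrite mbox//; exact/esym/lebesgue_rV_box.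
- move=> k; rewrite mbox; last by move=> i; exact: measurable_itv.
  rewrite ltey_eq prode_fin_num// => i _.
  by rewrite lebesgue_measure_itv/=; case: ifP.
Qed.

(** An identity of measures, once known on Borel sets, becomes a change of
    variables for nonnegative integrands. *)
Lemma ge0_integral_rV_transfer n (h : 'rV[R]_n -> 'rV[R]_n) (c : {nonneg R}) :
  measurable_fun [set: 'rV[R]_n] h ->
  (forall A, measurable A -> lebesgue_rV A = c%:num%:E * lebesgue_rV (h @^-1` A))%E ->
  forall f : 'rV[R]_n -> \bar R, measurable_fun [set: 'rV[R]_n] f -> (forall x, 0 <= f x)%E ->
  (\int[@lebesgue_rV R n]_x f x = c%:num%:E * \int[@lebesgue_rV R n]_x f (h x))%E.
Proof.
move=> mh hE f mf f0.
pose m : {measure set 'rV[R]_n -> \bar R} := mscale c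
  (measure_function_pushforward__canonical__measure_function_Measure
    (@lebesgue_rV R n) mh).
transitivity (\int[m]_x f x)%E.
  by apply: eq_measure_integral => A mA _; first [exact: hE | exact/esym/hE].
rewrite ge0_integral_mscale// ge0_integral_pushforward//.
Qed.

End lebesgue_unique.

(** * Scalings, shears and plane rotations *)

Section lebesgue1.
Context {R : realType}.
Local Notation lambda := (@lebesgue_measure R).

Lemma lebesgue_measure_preimage_scale (c : R) (A : set R) : 0 < c ->
  measurable A -> lambda ( *%R c @^-1` A) = ((c^-1)%:E * lambda A)%E.
Proof.
move=> c0 mA.
have mc : measurable_fun [set: measurableTypeR R]
    ( *%R c : measurableTypeR R -> measurableTypeR R).
  exact: measurable_funM.
pose k : {nonneg R} := NngNum (ltW c0).
pose m : {measure set (measurableTypeR R) -> \bar R} := mscale k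
  (measure_function_pushforward__canonical__measure_function_Measure lambda mc).
have -> : lambda A = m A.
  apply: lebesgue_measure_unique => // _ [[a b]] _ <-.
  rewrite /m /= /mscale /= /pushforward.
  rewrite (_ : _ @^-1` _ = `]c^-1 * a, c^-1 * b]%classic); last first.
    apply/seteqP; split => x /=; rewrite !in_itv /=;
    by rewrite ltr_pdivrMl// ler_pdivlMl.
  rewrite !lebesgue_measure_itv/= !lte_fin ltr_pM2l ?invr_gt0//.
  case: ifP => _; last by rewrite mule0.
  by rewrite -!EFinB -EFinM -mulrBr mulVKf// gt_eqF.
rewrite /m /= /mscale /= /pushforward muleA -EFinM mulVf ?gt_eqF// mul1e.
by [].
Qed.

Lemma lebesgue_measure_preimage_shift (c : R) (A : set R) :
  measurable A -> lambda ((fun t => t + c) @^-1` A) = lambda A.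
Proof.
move=> mA.
have mc : measurable_fun [set: measurableTypeR R]
    ((fun t => t + c) : measurableTypeR R -> measurableTypeR R).
  exact: measurable_funD.
pose m : {measure set (measurableTypeR R) -> \bar R} := 
  (measure_function_pushforward__canonical__measure_function_Measure lambda mc).
have -> : lambda A = m A; last by [].
apply: lebesgue_measure_unique => // _ [[a b]] _ <-.
rewrite /m /= /pushforward.
rewrite (_ : _ @^-1` _ = `]a - c, b - c]%classic); last first.
  apply/seteqP; split => x /=; rewrite !in_itv /=;
    by rewrite ltrBlDr lerBrDr.
rewrite !lebesgue_measure_itv/= !lte_fin ltrD2r.
case: ifP => // _.
by rewrite -!EFinB opprB addrA subrK.
Qed.

End lebesgue1.

Section invariance.
Context {R : realType}.
Local Notation lambda := (@lebesgue_measure R).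

Definition scale_rV n (s : 'I_n -> R) (x : 'rV[R]_n) : 'rV[R]_n :=
  \row_i (s i * x ord0 i).

Lemma measurable_scale_rV n (s : 'I_n -> R) :
  measurable_fun [set: 'rV[R]_n] (scale_rV s).
Proof.
apply: measurable_fun_coordP => i.
under eq_fun do rewrite mxE.
by apply: measurable_funM => //; exact: measurable_coord.
Qed.

(** A diagonal scaling maps boxes to boxes, whence the Jacobian. *)
Lemma lebesgue_rV_scale n (s : 'I_n -> R) (c : {nonneg R}) :
  (forall i, 0 < s i) -> c%:num = \prod_i s i ->
  forall A, measurable A ->
    (lebesgue_rV A = c%:num%:E * lebesgue_rV (scale_rV s @^-1` A))%E.
Proof.
move=> s0 cE A mA.
pose m : {measure set 'rV[R]_n -> \bar R} := mscale c
  (measure_function_pushforward__canonical__measure_function_Measure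
    (@lebesgue_rV R n) (@measurable_scale_rV n s)).
rewrite -[RHS]/(m A); apply/esym/lebesgue_rV_unique => // {mA}A mA.
rewrite /m /= /mscale /= /pushforward.
rewrite [X in lebesgue_rV X](_ : _ =
    box (fun i => ( *%R (s i)) @^-1` (A i))); last first.
  by apply/seteqP; split => x /= Ax i; have := Ax i; rewrite mxE.
have mA' i : measurable (( *%R (s i)) @^-1` (A i)).
  rewrite -[X in measurable X]setTI.
  suff : measurable_fun setT ( *%R (s i)) by apply.
  exact: measurable_funM.
rewrite (lebesgue_rV_box mA').
rewrite (eq_bigr (fun i => ((s i)^-1%:E * lambda (A i))%E)); last first.
  by move=> i _; exact: lebesgue_measure_preimage_scale.
rewrite big_split/= muleA cE; set P := (\prod_i _%:E)%E.
suff -> : ((\prod_i s i)%:E * P = 1)%E by rewrite mul1e.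
rewrite /P prodEFin -EFinM -big_split/= big1// => i _.
by rewrite divff// gt_eqF.
Qed.

Definition lebesgue_preserving n (h : 'rV[R]_n -> 'rV[R]_n) :=
  measurable_fun [set: 'rV[R]_n] h /\
  forall A, measurable A -> lebesgue_rV (h @^-1` A) = lebesgue_rV A.

Lemma lebesgue_preserving_comp n (g h : 'rV[R]_n -> 'rV[R]_n) :
  lebesgue_preserving g -> lebesgue_preserving h -> lebesgue_preserving (g \o h).
Proof.
move=> [mg gE] [mh hE]; split; first exact: measurableT_comp.
move=> A mA; rewrite comp_preimage hE ?gE//.
by rewrite -[X in measurable X]setTI; exact: mg.
Qed.

Lemma lebesgue_preserving_perm n (s : {perm 'I_n}) :
  lebesgue_preserving (col_perm s : 'rV[R]_n -> 'rV[R]_n).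
Proof.
have mh : measurable_fun [set: 'rV[R]_n] (col_perm s : 'rV[R]_n -> 'rV[R]_n).
  apply: measurable_fun_coordP => i; under eq_fun do rewrite mxE.
  exact: measurable_coord.
split => // A mA.
pose m : {measure set 'rV[R]_n -> \bar R} :=
  (measure_function_pushforward__canonical__measure_function_Measure
    (@lebesgue_rV R n) mh).
rewrite -[LHS]/(m A); apply: lebesgue_rV_unique => // {mA}A mA.
rewrite /m /= /pushforward.
rewrite [X in lebesgue_rV X](_ : _ = box (fun i => A ((s^-1)%g i))); last first.
  apply/seteqP; split => x /= Ax i.
    by have := Ax ((s^-1)%g i); rewrite mxE permKV.
  by have := Ax (s i); rewrite mxE permK.
rewrite (@lebesgue_rV_box _ _ (fun i => A ((s^-1)%g i)))//.
by rewrite [RHS](reindex_inj (@perm_inj _ (s^-1)%g)).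
Qed.

(** The first coordinate is the inner variable of the iterated integral, and is
    translated by an amount that is constant in the inner integral. *)
Lemma lebesgue_preserving_shear0 n (g : 'rV[R]_n -> R)
    (h : 'rV[R]_n.+1 -> 'rV[R]_n.+1) :
  measurable_fun [set: 'rV[R]_n.+1] h ->
  (forall y t, h (rV_cons (y, t)) = rV_cons (y, t + g y)) ->
  lebesgue_preserving h.
Proof.
move=> mh hE; split => // A mA.
rewrite /lebesgue_rV /= /lebesgue_step /pushforward /= /product_measure1 /=.
apply: eq_integral => y _ /=.
have mB : measurable (@rV_cons R n @^-1` A).
  by rewrite -[X in measurable X]setTI; exact: measurable_rV_cons.
rewrite -[RHS](lebesgue_measure_preimage_shift (g y)); last first.
  exact: (@measurable_xsection _ _ _ (measurableTypeR R)).
congr (lebesgue_measure _); apply/seteqP; split => t /=;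
  by rewrite /xsection /= !in_setE /= hE.
Qed.

Definition shear n (i k : 'I_n) (c : R) (x : 'rV[R]_n) : 'rV[R]_n :=
  \row_l (x ord0 l + (if l == i then c * x ord0 k else 0)).

(** Conjugating by the transposition of 0 and i brings the sheared coordinate to
    the innermost integral. *)
Lemma lebesgue_preserving_shear n (i k : 'I_n) (c : R) : i != k ->
  lebesgue_preserving (shear i k c).
Proof.
case: n i k => [[//]|n] i k ik.
have mshear (j l : 'I_n.+1) : measurable_fun [set: 'rV[R]_n.+1] (shear j l c).
  apply: measurable_fun_coordP => r; under eq_fun do rewrite mxE.
  apply: measurable_funD; first exact: measurable_coord.
  case: (r == j) => //; apply: measurable_funM => //.
  exact: measurable_coord.
pose s := tperm ord0 i.
have sE l : (s l == ord0) = (l == i).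
  have <- : s i = ord0 by rewrite /s tpermR.
  by rewrite (inj_eq perm_inj).
have sk : s k != ord0 by rewrite sE eq_sym.
have -> : shear i k c = col_perm s \o shear ord0 (s k) c \o col_perm s.
  apply/funext => x; apply/rowP => l; rewrite /= !mxE.
  by rewrite sE /s !tpermK.
apply: lebesgue_preserving_comp; last exact: lebesgue_preserving_perm.
apply: lebesgue_preserving_comp; first exact: lebesgue_preserving_perm.
case: (unliftP ord0 (s k)) sk => [j|] ->; last by rewrite eqxx.
move=> _; apply: (@lebesgue_preserving_shear0 _ (fun y => c * y ord0 j)) => //.
move=> y t; apply/rowP => l; rewrite mxE.
case: (unliftP ord0 l) => [l'|] ->.
  by rewrite !rV_consS /= addr0.
by rewrite eqxx !rV_cons0 /= rV_consS.
Qed.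

Definition rot n (i k : 'I_n) (c s : R) (x : 'rV[R]_n) : 'rV[R]_n :=
  \row_l (if l == i then c * x ord0 i - s * x ord0 k
          else if l == k then s * x ord0 i + c * x ord0 k else x ord0 l).

(** A plane rotation is a product of three shears unless s = 0, where the first
    shear would have slope (c - 1) / s; the half-turn is the square of a
    quarter-turn. *)
Lemma lebesgue_preserving_rot n (i k : 'I_n) (c s : R) : i != k ->
  c ^+ 2 + s ^+ 2 = 1 -> lebesgue_preserving (rot i k c s).
Proof.
move=> ik.
have rot_shear c' s' : c' ^+ 2 + s' ^+ 2 = 1 -> s' != 0 ->
    lebesgue_preserving (rot i k c' s').
  move=> cs s0; pose a := (c' - 1) / s'.
  have as' : a * s' = c' - 1 by rewrite /a mulfVK.
  have -> : rot i k c' s' = shear i k a \o shear k i s' \o shear i k a.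
    apply/funext => x; apply/rowP => l; rewrite /= !mxE.
    have ki : k == i = false by rewrite eq_sym; exact: negbTE.
    rewrite !eqxx ki !addr0; have [->|li] := eqVneq l i.
      rewrite ?(negbTE ik) ?addr0.
      have h : s' + a * (2 + a * s') = 0.
        apply: (mulfI s0); rewrite mulr0.
        have -> : s' * (s' + a * (2 + a * s')) =
          s' ^+ 2 + (a * s') * (2 + a * s') by ring.
        rewrite as'; lra.
      apply: subr0_eq; have -> : c' = 1 + a * s' by lra.
      transitivity (- (s' + a * (2 + a * s')) * x ord0 k); first ring.
      by rewrite h oppr0 mul0r.
    have [->|lk] := eqVneq l k; last by rewrite !addr0.
    have -> : c' = 1 + a * s' by lra.
    ring.
  by do ![apply: lebesgue_preserving_comp]; apply: lebesgue_preserving_shear;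
    rewrite // eq_sym.
move=> cs; have [s0|s0] := eqVneq s 0; last exact: rot_shear.
have quarter : lebesgue_preserving (rot i k 0 1).
  by apply: rot_shear; rewrite ?oner_neq0// expr0n expr1n add0r.
have : c = 1 \/ c = -1.
  have : c ^+ 2 == 1 ^+ 2 by rewrite expr1n -cs s0 expr0n addr0.
  by rewrite eqf_sqr => /orP[] /eqP; [left|right].
rewrite s0; case=> ->.
  have -> : rot i k 1 0 = id.
    apply/funext => x; apply/rowP => l; rewrite !mxE !mul0r !mul1r subr0 add0r.
    by case: eqP => [->|_] //; case: eqP => [->|_].
  by split => [|A mA]; [exact: measurable_id|].
have -> : rot i k (-1) 0 = rot i k 0 1 \o rot i k 0 1.
  apply/funext => x; apply/rowP => l; rewrite /= !mxE !eqxx.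
  have ki : k == i = false by rewrite eq_sym; exact: negbTE.
  rewrite ki; case: eqP => [_|_]; first ring.
  case: eqP => [_|//]; ring.
exact: lebesgue_preserving_comp.
Qed.

End invariance.

(** * Chain rules and functions of class C^1 *)

Section chain_rules.
Context {R : realType}.

Lemma is_derive_line (V W : normedModType R) (f : V -> W) (p v : V) (t : R) :
  derivable f (t *: v + p) v ->
  is_derive t 1 (fun s : R => f (s *: v + p)) ('D_v f (t *: v + p)).
Proof.
move=> df.
have E : (fun h : R => h^-1 *: (f (h *: v + (t *: v + p)) - f (t *: v + p))) =
    (fun h : R => h^-1 *: (((fun s : R => f (s *: v + p)) \o shift t) (h *: (1 : R^o))
       - f (t *: v + p))).
  by apply/funext => h /=; rewrite scalerDl addrA [_%:A]mulr1.
apply: DeriveDef; first by rewrite /derivable -E.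
by rewrite /derive -E.
Qed.

Lemma is_derive_comp1 (V : normedModType R) (g : R -> R) (f : V -> R)
    (x v : V) (dg df : R) :
  is_derive (f x) 1 g dg -> is_derive x v f df ->
  is_derive x v (g \o f) (dg * df).
Proof.
move=> hg [hf <-].
have hf' : derivable f ((0 : R) *: v + x) v by rewrite scale0r add0r.
have h1 := is_derive_line hf'.
rewrite scale0r add0r in h1.
have hg' : is_derive ((fun s : R => f (s *: v + x)) 0) 1 g dg.
  by rewrite scale0r add0r.
have [h2 h3] := @is_derive1_comp R g (fun s : R => f (s *: v + x)) 0 _ _ hg' h1.
apply: DeriveDef; first by apply/derivable1P; exact: h2.
rewrite -h3 /derive.
set F := (X in X @ _); set G := (X in _ = lim (X @ _)).
suff -> : F = G by [].
by apply/funext => h; rewrite /F /G /= addr0 scale0r add0r [_%:A]mulr1.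
Qed.

Lemma is_derive_coord m (i : 'I_m) (x v : 'rV[R]_m) :
  is_derive x v (fun y : 'rV[R]_m => y ord0 i : R^o) (v ord0 i).
Proof.
have /derivable_mxP/(_ ord0 i) dc := @derivable_id _ _ x v.
apply: DeriveDef => //.
have := derive_mx (@derivable_id _ _ x v); rewrite derive_id => /rowP/(_ i).
by rewrite mxE => ->.
Qed.

End chain_rules.

Section C1.
Context {R : realType} {m : nat}.

Definition linear_form (c : 'I_m -> R) (h : 'rV[R]_m) : R^o :=
  \sum_i h ord0 i * c i.

Let linear_form_linear c : linear (linear_form c).
Proof.
move=> a u v; rewrite /linear_form scaler_sumr -big_split/=.
by apply: eq_bigr => i _; rewrite !mxE mulrDl -mulrA.
Qed.

HB.instance Definition _ c := GRing.isLinear.Build R 'rV[R]_m R^o _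
  (linear_form c) (linear_form_linear c).

Lemma coord_le_norm (x : 'rV[R]_m) i : `|x ord0 i| <= `|x|.
Proof.
rewrite [leRHS]/Num.Def.normr/= mx_normrE.
exact: (le_bigmax _ (fun j : 'I_1 * 'I_m => `|x j.1 j.2|) (ord0, i)).
Qed.

Lemma norm_le_coord (x : 'rV[R]_m) e : 0 <= e ->
  (forall i, `|x ord0 i| <= e) -> `|x| <= e.
Proof.
move=> e0 xe; rewrite [leLHS]/Num.Def.normr/= mx_normrE.
by rewrite bigmax_le => // -[i j] _ /=; rewrite (ord1 i).
Qed.

Lemma partial_increment (f : 'rV[R]_m -> R) (k : 'I_m) (p : 'rV[R]_m) (a : R) :
  (forall x, derivable f x (delta_mx ord0 k)) ->
  exists2 t : R, 0 <= t <= 1 &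
    f (a *: delta_mx ord0 k + p) - f p =
    partial k f ((t * a) *: delta_mx ord0 k + p) * a.
Proof.
move=> df; set e := delta_mx ord0 k.
pose G (t : R) := f (t *: e + p).
have dG (t : R) : is_derive t 1 G (partial k f (t *: e + p)) by exact: is_derive_line.
have dg (t : R) : is_derive t 1 (fun s => G (s * a)) (partial k f ((t * a) *: e + p) * a).
  have h : is_derive t (1 : R) (fun s : R => s * a) a.
    apply: (@is_derive_eq _ _ _ (id * cst a : R -> R)).
    by rewrite scaler0 add0r [_ *: _]mulr1.
  exact: (@is_derive1_comp _ G (fun s : R => s * a) t _ _ (dG _) h).
have [|t] := @MVT_segment R (fun s => G (s * a)) _ 0 1 ler01 (fun t _ => dg t).
  apply: derivable_within_continuous => t _.
  by have [] := dg t.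
rewrite in_itv /= => t01; rewrite mul1r mul0r subr0 mulr1 /G scale0r add0r.
by move=> E; exists t.
Qed.

(** The increment is split into increments along the coordinate axes, each
    controlled by the mean value theorem. Test functions are given by their
    partial derivatives only, while differentiation along orbits of dilations
    and rotations needs genuine differentiability. *)
Lemma C1_differentiable (f : 'rV[R]_m -> R^o) (x : 'rV[R]_m) :
  (forall k y, derivable f y (delta_mx ord0 k)) ->
  (forall k, {for x, continuous (partial k f)}) ->
  differentiable f x /\
  forall h, 'd f x h = \sum_i h ord0 i * partial i f x.
Proof.
move=> df cf; pose c i := partial i f x.
pose df0 : {linear 'rV[R]_m -> R^o} := linear_form c.
have fE : f \o shift x = cst (f x) + (df0 : 'rV[R]_m -> R^o) +o_ (0 : 'rV[R]_m) id.
  apply/eqaddoP => e e0 /=.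
  pose e' := e / m.+1%:R.
  have e'0 : 0 < e' by rewrite divr_gt0.
  have [d d0 dE] : exists2 d, 0 < d &
      forall k y, `|y - x| < d -> `|partial k f y - c k| <= e'.
    have H k : \forall y \near x, `|partial k f y - c k| <= e'.
      have /cvgrPdist_le/(_ _ e'0) := cf k.
      by apply: filterS => y; rewrite distrC.
    have /nbhs_ballP[d /= d0 dE] : \forall y \near x, forall k, `|partial k f y - c k| <= e'.
      exact: (@filter_forall _ _ (fun k y => is_true (`|partial k f y - c k| <= e')) (nbhs x) _ H).
    exists d => // k y yx; apply: dE; rewrite -ball_normE /=.
    by rewrite distrC.
  near=> h.
  have hd : `|h| < d by near: h; exact: (@nbhs0_lt _ 'rV[R]_m).
  pose p (k : nat) : 'rV[R]_m := x + \row_i (if (i < k)%N then h ord0 i else 0).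
  have pS (k : 'I_m) : p k.+1 = h ord0 k *: delta_mx ord0 k + p k.
    apply/rowP => i; rewrite !mxE eqxx /= ltnS leq_eqVlt.
    have [->|ik] := eqVneq i k; first by rewrite eqxx ltnn /= mulr1 addrC addr0.
    by rewrite -val_eqE /= in ik; rewrite (negbTE ik) /= mulr0 add0r.
  have p0 : p 0 = x by apply/rowP => i; rewrite !mxE addr0.
  have pm : p m = h + x.
    by apply/rowP => i; rewrite !mxE ltn_ord addrC.
  rewrite !fctE /= -pm.
  have -> : f (p m) - (f x + linear_form c h) =
      \sum_(k < m) (f (p k.+1) - f (p k) - h ord0 k * c k).
    rewrite sumrB opprD addrA; congr (_ - _).
    rewrite -(big_mkord predT (fun k => f (p k.+1) - f (p k))).
    by rewrite telescope_sumr// p0.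
  apply: le_trans (ler_norm_sum _ _ _) _.
  apply: (@le_trans _ _ (\sum_(k < m) e' * `|h|)); last first.
    rewrite sumr_const card_ord -mulrnAl ler_wpM2r// -mulr_natr /e' mulrAC.
    by rewrite ler_pdivrMr// ler_wpM2l ?ler_nat// ltW.
  apply: ler_sum => k _; rewrite pS.
  have [t t01 ->] := @partial_increment f k (p k) (h ord0 k) (df k).
  rewrite mulrC -mulrBr normrM mulrC ler_pM ?coord_le_norm//.
  apply: dE; apply: le_lt_trans hd; apply: norm_le_coord => // i.
  rewrite !mxE eqxx /=; have [->|ik] := eqVneq i k.
    rewrite ltnn mulr1 addr0 addrK normrM.
    rewrite (le_trans _ (coord_le_norm h k))// ler_piMl//.
    by case/andP: t01 => t0 t1; rewrite ger0_norm.
  rewrite mulr0 add0r addrC addKr; case: ifP => _; last by rewrite normr0.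
  exact: coord_le_norm.
have lc : continuous (linear_form c).
  apply: (@continuous_big R^o 'I_m +%R 0 xpredT); first exact: add_continuous.
  move=> i _ y.
  have FF : Filter (nbhs (y : 'rV[R]_m)) by exact: nbhs_filter.
  by apply: (@cvgM R _ _ FF); [exact: coord_continuous|exact: cvg_cst].
have dE := diff_unique lc fE.
split; last by move=> h; rewrite dE.
by apply/diff_locallyP; rewrite dE.
Unshelve. all: by end_near. Qed.

Lemma is_derive_curve (f : 'rV[R]_m -> R) (g : R -> 'rV[R]_m) (t : R) (dg : 'I_m -> R) :
  (forall k y, derivable f y (delta_mx ord0 k)) ->
  (forall k, continuous (partial k f)) ->
  (forall i, is_derive t 1 (fun s => g s ord0 i : R^o) (dg i)) ->
  is_derive t 1 (f \o g) (\sum_i dg i * partial i f (g t)).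
Proof.
move=> df cf hg.
have dgt : derivable g t 1.
  by apply/derivable_mxP => i j; rewrite (ord1 i); have [] := hg j.
have [ff fE] := C1_differentiable (x := g t) df (fun k => cf k _).
have gd : differentiable g t by exact/derivable1_diffP.
apply: DeriveDef.
  by apply/derivable1_diffP; exact: differentiable_comp.
rewrite deriveE; last exact: differentiable_comp.
rewrite diff_comp//= fE; apply: eq_bigr => i _; congr (_ * _).
by rewrite -deriveE// (derive_mx dgt) mxE; have [_ ->] := hg i.
Qed.

End C1.

(** * Algebra of the horizontal vector fields *)

Section formulas.
Context {R : realType} {n : nat} (L : 'I_n -> R).
Local Notation G := 'rV[R]_(n + n + 1).

Definition xi (i : 'I_n) : 'I_(n + n + 1) := xidx (lshift n i).
Definition yi (i : 'I_n) : 'I_(n + n + 1) := xidx (rshift n i).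
Local Notation ti := (@tidx n).

(** The squared length of the horizontal part; [gauge4] below is the fourth power
    of the gauge. *)
Definition horiz_sq (x : G) : R :=
  \sum_(i < n) 2 * `|L i| * x ord0 (xi i) ^+ 2 +
  \sum_(i < n) 2 * `|L i| * x ord0 (yi i) ^+ 2.

Definition gauge4 (x : G) : R := horiz_sq x ^+ 2 + 16 * x ord0 ti ^+ 2.

Lemma rhoE x : rho L x = gauge4 x `^ 4^-1. Proof. by []. Qed.

Lemma is_derive_horiz_sq (x v : G) : is_derive x v horiz_sq
  (\sum_(i < n) 4 * `|L i| * x ord0 (xi i) * v ord0 (xi i) +
   \sum_(i < n) 4 * `|L i| * x ord0 (yi i) * v ord0 (yi i)).
Proof.
have D k (c : R) : is_derive x v (fun y : G => c * y ord0 k ^+ 2)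
    (2 * c * x ord0 k * v ord0 k).
  have h := @is_derive_coord R _ k x v.
  apply: (@is_derive_eq _ _ _ (c *: (fun y : G => y ord0 k) ^+ 2)).
  by rewrite expr1 -!scalerAl /GRing.scale /= ; ring.
have DS (k : 'I_n -> 'I_(n + n + 1)) : is_derive x v
    (fun y : G => \sum_(i < n) 2 * `|L i| * y ord0 (k i) ^+ 2)
    (\sum_(i < n) 4 * `|L i| * x ord0 (k i) * v ord0 (k i)).
  have -> : (fun y : G => \sum_(i < n) 2 * `|L i| * y ord0 (k i) ^+ 2) =
      \sum_(i < n) (fun y : G => 2 * `|L i| * y ord0 (k i) ^+ 2).
    by apply/funext => y; rewrite fct_sumE.
  apply: is_derive_eq; apply: eq_bigr => i _; rewrite mulrA; congr (_ * _ * _ * _).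
  ring.
exact: (is_deriveD (DS xi) (DS yi)).
Qed.

Lemma is_derive_gauge4 (x v : G) (df : R) : is_derive x v horiz_sq df ->
  is_derive x v gauge4 (2 * horiz_sq x * df + 32 * x ord0 ti * v ord0 ti).
Proof.
move=> h; have ht := @is_derive_coord R _ ti x v.
have gen (a : R) :
    is_derive x v (horiz_sq ^+ 2 + a *: ((fun y : G => y ord0 ti) ^+ 2))
      (2 * horiz_sq x * df + (2 * a) * x ord0 ti * v ord0 ti).
  have h1 := @is_deriveX _ _ horiz_sq 2 x v df h.
  have h2 := is_deriveZ a (@is_deriveX _ _ (fun y : G => y ord0 ti) 2 x v _ ht).
  by apply: is_derive_eq (is_deriveD h1 h2) _; rewrite !expr1 /GRing.scale /=; ring.
have -> : gauge4 = horiz_sq ^+ 2 + 16 *: ((fun y : G => y ord0 ti) ^+ 2).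
  by apply/funext => y; rewrite /gauge4; move: 16 => a.
by apply: is_derive_eq (gen 16) _; congr (_ + _ * _ * _); ring.
Qed.

Lemma coord_delta (k l : 'I_(n + n + 1)) :
  (delta_mx ord0 k : G) ord0 l = (l == k)%:R.
Proof. by rewrite mxE eqxx. Qed.

Lemma xi_inj : injective xi.
Proof. by move=> i j /lshift_inj/lshift_inj. Qed.
Lemma yi_inj : injective yi.
Proof. by move=> i j /lshift_inj/rshift_inj. Qed.
Lemma xi_yi i j : (xi i == yi j) = false.
Proof.
by apply/negbTE/eqP => /(congr1 val)/= ij; have := ltn_ord i; rewrite ij ltnNge leq_addr.
Qed.
Lemma xi_ti i : (xi i == ti) = false.
Proof. by rewrite /xi /xidx /tidx eq_lrshift. Qed.
Lemma yi_ti i : (yi i == ti) = false.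
Proof. by rewrite /yi /xidx /tidx eq_lrshift. Qed.

Lemma index_cases (P : 'I_(n + n + 1) -> Prop) :
  (forall i, P (xi i)) -> (forall i, P (yi i)) -> P ti -> forall k, P k.
Proof.
move=> hx hy ht k; rewrite -(splitK k); case: (fintype.split k) => [j|j] /=.
  by rewrite -(splitK j); case: (fintype.split j) => i /=; [exact: hx|exact: hy].
by rewrite (ord1 j).
Qed.

Lemma sum_delta (k : 'I_n -> 'I_(n + n + 1)) (i : 'I_n) (F : 'I_n -> R) :
  injective k -> \sum_j F j * (k j == k i)%:R = F i.
Proof.
move=> ik; rewrite (bigD1 i)//= eqxx mulr1 big1 ?addr0// => j ji.
by rewrite (inj_eq ik) (negbTE ji) mulr0.
Qed.

Lemma sum_delta0 (k : 'I_n -> 'I_(n + n + 1)) l (F : 'I_n -> R) :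
  (forall j, (k j == l) = false) -> \sum_j F j * (k j == l)%:R = 0.
Proof. by move=> kl; rewrite big1// => j _; rewrite kl mulr0. Qed.

Lemma partial_horiz_sq k x : partial k horiz_sq x =
  \sum_(i < n) 4 * `|L i| * x ord0 (xi i) * (xi i == k)%:R +
  \sum_(i < n) 4 * `|L i| * x ord0 (yi i) * (yi i == k)%:R.
Proof.
rewrite /partial (@derive_val _ _ _ _ _ _ _ (is_derive_horiz_sq x _)).
by congr (_ + _); apply: eq_bigr => i _; rewrite coord_delta.
Qed.

Lemma partial_horiz_sq_x i x : partial (xi i) horiz_sq x = 4 * `|L i| * x ord0 (xi i).
Proof.
rewrite partial_horiz_sq.
rewrite (sum_delta _ _ xi_inj) sum_delta0 ?addr0// => j; by rewrite eq_sym xi_yi.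
Qed.

Lemma partial_horiz_sq_y i x : partial (yi i) horiz_sq x = 4 * `|L i| * x ord0 (yi i).
Proof.
rewrite partial_horiz_sq.
rewrite (sum_delta _ _ yi_inj) sum_delta0 ?add0r// => j; by rewrite xi_yi.
Qed.

Lemma partial_horiz_sq_t x : partial ti horiz_sq x = 0.
Proof.
rewrite partial_horiz_sq.
by rewrite !sum_delta0 ?addr0// => j; rewrite (xi_ti, yi_ti).
Qed.

Lemma derivable_horiz_sq x v : derivable horiz_sq x v.
Proof. by have [] := is_derive_horiz_sq x v. Qed.

Lemma derivable_gauge4 x v : derivable gauge4 x v.
Proof. by have [] := is_derive_gauge4 (is_derive_horiz_sq x v). Qed.

Lemma partial_gauge4 k x :
  partial k gauge4 x = 2 * horiz_sq x * partial k horiz_sq x + 32 * x ord0 ti * (ti == k)%:R.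
Proof.
rewrite /partial; have h := is_derive_gauge4 (derivableP (@derivable_horiz_sq x (delta_mx ord0 k))).
by rewrite (@derive_val _ _ _ _ _ _ _ h) coord_delta.
Qed.

Lemma vfX_l i f x : vfX L (lshift n i) f x =
  partial (xi i) f x - L i * x ord0 (yi i) * partial ti f x.
Proof. by rewrite /vfX (unsplitK (inl i)). Qed.

Lemma vfX_r i f x : vfX L (rshift n i) f x =
  partial (yi i) f x + L i * x ord0 (xi i) * partial ti f x.
Proof. by rewrite /vfX (unsplitK (inr i)). Qed.

Lemma ell_l i : ell L (lshift n i) = `|L i|.
Proof. by rewrite /ell (unsplitK (inl i)). Qed.

Lemma ell_r i : ell L (rshift n i) = `|L i|.
Proof. by rewrite /ell (unsplitK (inr i)). Qed.

Definition hpair (f g : G -> R) (x : G) : R := \sum_j vfY L j f x * vfY L j g x.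

Hypothesis L0 : forall i, L i != 0.

Lemma ell_gt0 j : 0 < ell L j.
Proof. by rewrite /ell; case: fintype.split => i; rewrite normr_gt0. Qed.

Lemma hpairE f g x : hpair f g x =
  \sum_(i < n) (2 * `|L i|)^-1 *
    (vfX L (lshift n i) f x * vfX L (lshift n i) g x +
     vfX L (rshift n i) f x * vfX L (rshift n i) g x).
Proof.
rewrite /hpair big_split_ord /= -big_split /=; apply: eq_bigr => i _.
have E j : vfY L j f x * vfY L j g x =
    (2 * ell L j)^-1 * (vfX L j f x * vfX L j g x).
  rewrite /vfY mulrACA -invfM -expr2 sqr_sqrtr// mulr_ge0// ltW//.
  exact: ell_gt0.
by rewrite !E ell_l ell_r mulrDr.
Qed.

(** The generator of the dilations (x, t) -> (s x, s^2 t). *)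
Definition euler (f : G -> R) (x : G) : R :=
  \sum_(i < n) (x ord0 (xi i) * partial (xi i) f x +
                x ord0 (yi i) * partial (yi i) f x) +
  2 * x ord0 ti * partial ti f x.

(** The sum over i of the infinitesimal rotations of the planes (x_i, x_{i+n}),
    oriented by the signs of the L_i. *)
Definition angular (f : G -> R) (x : G) : R :=
  \sum_(i < n) L i / `|L i| * (x ord0 (xi i) * partial (yi i) f x -
                               x ord0 (yi i) * partial (xi i) f x).

(** The identity behind the whole proof: the gradient of the gauge splits into a
    dilation part and a rotation part. It is linear in the partial derivatives
    of f, hence holds for an arbitrary function. Writing L_i = l s with s^2 = 1,
    it is an identity of polynomials for each i. *)
Lemma hpair_gauge4 f x : hpair gauge4 f x =
  4 * (horiz_sq x * euler f x + 4 * x ord0 ti * angular f x).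
Proof.
rewrite hpairE /euler /angular [horiz_sq x * (_ + _)]mulrDr.
have -> : horiz_sq x * (2 * x ord0 ti * partial ti f x) = \sum_(i < n)
    4 * `|L i| * (x ord0 (xi i) ^+ 2 + x ord0 (yi i) ^+ 2) *
      x ord0 ti * partial ti f x.
  rewrite /horiz_sq -big_split /= mulr_suml; apply: eq_bigr => i _; ring.
rewrite !mulr_sumr -!big_split /= mulr_sumr; apply: eq_bigr => i _.
rewrite !vfX_l !vfX_r !partial_gauge4 partial_horiz_sq_x partial_horiz_sq_y partial_horiz_sq_t.
rewrite eqxx ![ti == _]eq_sym xi_ti yi_ti.
set l : R := `|L i|; have l0 : l != 0 by rewrite normr_eq0.
have L2 : L i ^+ 2 = l ^+ 2 by rewrite /l real_normK// num_real.
move: (L i) l l0 L2 => a l l0 L2.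
have aE : a = l * (a / l) by field.
have s2 : (a / l) ^+ 2 = 1 by rewrite expr_div_n L2 divff// expf_neq0.
move: (a / l) aE s2 => s -> s2.
rewrite /= mulr0n mulr1n.
move: (x _ (xi i)) (x _ (yi i)) (x _ ti) (horiz_sq x) => a1 a2 t d.
move: (partial (xi i) f x) (partial (yi i) f x) (partial ti f x) => f1 f2 f3.
by field: s2.
Qed.

End formulas.

(** * The gauge: gradient, smoothness and infinity-harmonicity *)

Section gauge.
Context {R : realType} {n : nat} (L : 'I_n -> R).
Local Notation G := 'rV[R]_(n + n + 1).
Local Notation ti := (@tidx n).
Local Notation dd := (horiz_sq L).
Local Notation NN := (gauge4 L).
Hypothesis L0 : forall i, L i != 0.

Lemma horiz_sq_ge0 (x : G) : 0 <= dd x.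
Proof.
by rewrite /horiz_sq addr_ge0// sumr_ge0// => i _; rewrite mulr_ge0 ?sqr_ge0// mulr_ge0.
Qed.

Lemma horiz_sq_ge_x i (x : G) : 2 * `|L i| * x ord0 (xi i) ^+ 2 <= dd x.
Proof.
rewrite /horiz_sq (bigD1 i)//= -addrA lerDl addr_ge0// sumr_ge0// => j _;
by rewrite mulr_ge0 ?sqr_ge0// mulr_ge0.
Qed.

Lemma horiz_sq_ge_y i (x : G) : 2 * `|L i| * x ord0 (yi i) ^+ 2 <= dd x.
Proof.
rewrite /horiz_sq addrC (bigD1 i)//= -addrA lerDl addr_ge0// sumr_ge0// => j _;
by rewrite mulr_ge0 ?sqr_ge0// mulr_ge0.
Qed.

Lemma horiz_sq_eq0 (x : G) : dd x = 0 -> forall i, x ord0 (xi i) = 0 /\ x ord0 (yi i) = 0.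
Proof.
move=> d0 i.
have l0 : 0 < 2 * `|L i| by rewrite mulr_gt0// normr_gt0.
have := horiz_sq_ge_x i x; have := horiz_sq_ge_y i x; rewrite d0 !(pmulr_rle0 _ l0) => hy hx.
by split; apply/eqP; rewrite -sqrf_eq0 eq_le sqr_ge0 andbT.
Qed.

Lemma gauge4_ge0 (x : G) : 0 <= NN x.
Proof. by rewrite /gauge4 addr_ge0 ?sqr_ge0// mulr_ge0// sqr_ge0. Qed.

Lemma gauge4_gt0 (x : G) : x != 0 -> 0 < NN x.
Proof.
move=> x0; rewrite lt_neqAle gauge4_ge0 andbT eq_sym; apply: contra x0 => /eqP N0.
have : dd x ^+ 2 <= 0 by rewrite -N0 /gauge4 lerDl mulr_ge0// sqr_ge0.
have : 16 * x ord0 ti ^+ 2 <= 0 by rewrite -N0 /gauge4 lerDr sqr_ge0.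
rewrite pmulr_rle0// => t0 d0.
have {}t0 : x ord0 ti = 0 by apply/eqP; rewrite -sqrf_eq0 eq_le t0 sqr_ge0.
have {}d0 : dd x = 0 by apply/eqP; rewrite -sqrf_eq0 eq_le d0 sqr_ge0.
apply/eqP/rowP => k; rewrite mxE; move: k.
by apply: index_cases => // i; have [] := horiz_sq_eq0 d0 i.
Qed.

Lemma rho_ge0 (x : G) : 0 <= rho L x. Proof. exact: powR_ge0. Qed.

Lemma rho_gt0 (x : G) : x != 0 -> 0 < rho L x.
Proof. by move=> x0; rewrite rhoE powR_gt0// gauge4_gt0. Qed.

Lemma rho4 (x : G) : rho L x ^+ 4 = NN x.
Proof.
by rewrite rhoE -powR_mulrn ?powR_ge0// -powRrM mulVf// powRr1// gauge4_ge0.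
Qed.

Lemma rho0 : rho L (0 : G) = 0.
Proof.
suff : rho L (0 : G) ^+ 4 == 0 by rewrite expf_eq0 => /andP[_ /eqP].
apply/eqP; rewrite rho4 /gauge4 /horiz_sq mxE.
rewrite !big1 => [|i _|i _]; rewrite ?mxE ?expr0n ?mulr0//.
by rewrite !(addr0, expr0n, mulr0).
Qed.

Lemma horiz_sq_le_rho (x : G) : dd x <= rho L x ^+ 2.
Proof.
rewrite -(@ler_pXn2r _ 2)//; [|exact: horiz_sq_ge0|exact: sqr_ge0].
rewrite -exprM rho4 /gauge4.
by rewrite lerDl mulr_ge0// sqr_ge0.
Qed.

Lemma t_le_rho (x : G) : 4 * `|x ord0 ti| <= rho L x ^+ 2.
Proof.
rewrite -(@ler_pXn2r _ 2)//; [|exact: mulr_ge0|exact: sqr_ge0].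
rewrite -exprM rho4 /gauge4.
rewrite exprMn real_normK ?num_real// -natrX.
by rewrite lerDr sqr_ge0.
Qed.

Lemma near_neq0 (x : G) : x != 0 -> \forall y \near x, y != 0.
Proof.
move=> x0; have oU : open (~` [set (0 : G)]).
  apply: closed_openC; apply: accessible_closed_set1.
  exact/hausdorff_accessible/norm_hausdorff.
have : nbhs x (~` [set (0 : G)]) by apply: open_nbhs_nbhs; split=> //; exact/eqP.
by apply: filterS => y /eqP.
Qed.

(** Polynomials in the coordinates and in powers and the logarithm of NN. This
    class is closed under differentiation and consists of functions continuous
    off the origin, so its members are smooth there. It contains the gauge and
    the functions Gamma. *)
Inductive elem : (G -> R) -> Prop :=
| elem_cst c : elem (cst c)
| elem_coord k : elem (fun x => x ord0 k)
| elem_add f g : elem f -> elem g -> elem (f \+ g)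
| elem_mul f g : elem f -> elem g -> elem (f \* g)
| elem_pow a : elem (fun x => NN x `^ a)
| elem_ln : elem (fun x => ln (NN x)).

Lemma elem_sum I (r : seq I) (F : I -> G -> R) :
  (forall i, elem (F i)) -> elem (fun x => \sum_(i <- r) F i x).
Proof.
move=> hF; elim: r => [|i r ih].
  by under eq_fun do rewrite big_nil; exact: elem_cst.
under eq_fun do rewrite big_cons.
exact: (elem_add (hF i) ih).
Qed.

Lemma elem_scale c f : elem f -> elem (fun x => c * f x).
Proof. exact: (elem_mul (elem_cst c)). Qed.

Lemma elem_sqr f : elem f -> elem (fun x => f x ^+ 2).
Proof. by move=> hf; exact: (elem_mul hf hf). Qed.

Lemma elem_horiz_sq : elem dd.
Proof.
by apply: elem_add; apply: elem_sum => i; apply/elem_scale/elem_sqr/elem_coord.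
Qed.

Let continuous_mul (f g : G -> R) :
  continuous f -> continuous g -> continuous (fun y => f y * g y).
Proof. by move=> cf cg y; exact: (continuousM (cf y) (cg y)). Qed.

Let continuous_add (f g : G -> R) :
  continuous f -> continuous g -> continuous (fun y => f y + g y).
Proof. by move=> cf cg y; exact: (continuousD (cf y) (cg y)). Qed.

Let continuous_coord2 (c : R) (k : 'I_(n + n + 1)) :
  continuous (fun y : G => c * y ord0 k ^+ 2).
Proof.
apply: continuous_mul => [y|]; first exact: cst_continuous.
by apply: continuous_mul => y; exact: coord_continuous.
Qed.

Lemma horiz_sq_continuous : continuous dd.
Proof.
by apply: continuous_add;
  apply: (@continuous_big R^o 'I_n +%R 0 xpredT) => [|i _];
  (exact: add_continuous || exact: continuous_coord2).
Qed.

Lemma gauge4_continuous : continuous NN.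
Proof.
apply: continuous_add; last exact: continuous_coord2.
by apply: continuous_mul; exact: horiz_sq_continuous.
Qed.

Lemma elem_continuous f x : elem f -> x != 0 -> {for x, continuous f}.
Proof.
move=> + x0; elim => [c|k|{}f g _ hf _ hg|{}f g _ hf _ hg|a|].
- exact: cst_continuous.
- exact: coord_continuous.
- exact: continuousD.
- exact: continuousM.
- apply: (@continuous_comp _ _ _ NN (fun y => y `^ a)); first exact: gauge4_continuous.
  apply/differentiable_continuous/derivable1_diffP.
  by have [] := is_derive1_powR a (gauge4_gt0 x0).
- apply: (@continuous_comp _ _ _ NN (@ln R)); first exact: gauge4_continuous.
  exact: continuous_ln (gauge4_gt0 x0).
Qed.

Lemma elem_is_derive f (k : 'I_(n + n + 1)) : elem f ->
  exists2 g, elem g & forall x, x != 0 -> is_derive x (delta_mx ord0 k) f (g x).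
Proof.
have eN : elem (partial k NN).
  have -> : partial k NN = (fun x => (2 * dd x) * (
  \sum_(i < n) 4 * `|L i| * x ord0 (xi i) * (xi i == k)%:R +
  \sum_(i < n) 4 * `|L i| * x ord0 (yi i) * (yi i == k)%:R) + 32 * x ord0 ti * (ti == k)%:R).
    by apply/funext => x; rewrite partial_gauge4 partial_horiz_sq.
  apply: elem_add; first apply: elem_mul; first exact/elem_scale/elem_horiz_sq.
    apply: elem_add; apply: elem_sum => i.
      by apply: elem_mul (elem_cst _); exact/elem_scale/elem_coord.
    by apply: elem_mul (elem_cst _); exact/elem_scale/elem_coord.
  by apply: elem_mul (elem_cst _); exact/elem_scale/elem_coord.
have dN x : is_derive x (delta_mx ord0 k) NN (partial k NN x).
  exact/derivableP/derivable_gauge4.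
elim => [c|l|{}f g ef [df edf hf] eg [dg edg hg]|{}f g ef [df edf hf] eg [dg edg hg]|a|].
- by exists (cst 0); [exact: elem_cst|move=> x _; exact: is_derive_cst].
- exists (cst (l == k)%:R); first exact: elem_cst.
  by move=> x _; rewrite /= -(coord_delta (R:=R)); exact: is_derive_coord.
- exists (df \+ dg); first exact: elem_add.
  by move=> x x0; exact: (is_deriveD (hf x x0) (hg x x0)).
- exists ((f \* dg) \+ (g \* df)); first by apply: elem_add; exact: elem_mul.
  by move=> x x0; exact: (is_deriveM (hf x x0) (hg x x0)).
- exists (fun x => a * NN x `^ (a - 1) * partial k NN x).
    by apply: elem_mul => //; exact/elem_scale/elem_pow.
  move=> x x0; apply: (is_derive_comp1 (g := fun y => y `^ a)) => //.
  exact/is_derive1_powR/gauge4_gt0.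
- exists (fun x => NN x `^ (- 1) * partial k NN x).
    by apply: elem_mul => //; exact/elem_pow.
  move=> x x0; apply: (is_derive_comp1 (g := @ln R)) => //.
  by rewrite powR_inv1 ?gauge4_ge0//; exact/is_derive1_ln/gauge4_gt0.
Qed.

Lemma near_partial f g k (x : G) : (\forall y \near x, f y = g y) ->
  partial k f x = partial k g x.
Proof. exact: near_eq_derive. Qed.

Lemma near_vfY f g j (x : G) : (\forall y \near x, f y = g y) ->
  vfY L j f x = vfY L j g x.
Proof.
move=> fg; rewrite /vfY /vfX; congr (_ * _).
by case: fintype.split => i; rewrite !(near_partial _ fg).
Qed.

Lemma elem_iter_partial s f : elem f -> exists2 g, elem g &
  forall x, x != 0 -> iter_partial s f x = g x.
Proof.
move=> ef; elim: s => [|k s [g eg hg]]; first by exists f.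
have [dg edg hdg] := elem_is_derive k eg.
exists dg => // x x0 /=; have [_ <-] := hdg x x0.
by apply: near_partial; near=> y; apply: hg; near: y; exact: near_neq0.
Unshelve. all: by end_near. Qed.

Lemma elem_smooth f : elem f -> smooth_on (~` [set 0]) f.
Proof.
move=> ef x /eqP x0 s; have [g eg hg] := elem_iter_partial s ef.
have near_g : \forall y \near x, g y = iter_partial s f y.
  by near=> y; rewrite hg//; near: y; exact: near_neq0.
split=> [|k].
  rewrite /prop_for /continuous_at hg//.
  by apply: (cvg_trans _ (elem_continuous eg x0)); apply: near_eq_cvg near_g.
have [dg _ /(_ x x0)[h _]] := elem_is_derive k eg.
exact: near_eq_derivable h.
Unshelve. all: by end_near. Qed.

Lemma elem_vfY f j : elem f -> exists2 g, elem g &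
  forall x, x != 0 -> vfY L j f x = g x.
Proof.
move=> ef; have [dt et ht] := elem_is_derive ti ef.
rewrite /vfY /vfX; case: (fintype.split j) => i.
  have [g eg hg] := elem_is_derive (xidx j) ef.
  exists (fun x => (Num.sqrt (2 * ell L j))^-1 *
     (g x + (- L i) * x ord0 (yi i) * dt x)).
    apply/elem_scale/elem_add => //; apply: elem_mul => //.
    exact/elem_scale/elem_coord.
  move=> x x0; rewrite /partial; have [_ ->] := hg x x0; have [_ ->] := ht x x0.
  by rewrite -!mulNr.
have [g eg hg] := elem_is_derive (xidx j) ef.
exists (fun x => (Num.sqrt (2 * ell L j))^-1 *
   (g x + L i * x ord0 (xi i) * dt x)).
  apply/elem_scale/elem_add => //; apply: elem_mul => //.
  exact/elem_scale/elem_coord.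
by move=> x x0; rewrite /partial; have [_ ->] := hg x x0; have [_ ->] := ht x x0.
Qed.

(** Being linear combinations of partial derivatives, the fields obey every
    differentiation rule that the partial derivatives obey. *)
Lemma vfY_linear (I : finType) (a : I -> R) (f : I -> G -> R) h x :
  (forall k, partial k h x = \sum_i a i * partial k (f i) x) ->
  forall j, vfY L j h x = \sum_i a i * vfY L j (f i) x.
Proof.
move=> hh j; under eq_bigr do rewrite /vfY mulrCA.
rewrite -mulr_sumr /vfY; congr (_ * _).
rewrite /vfX; case: fintype.split => i; rewrite !hh !mulr_sumr -?sumrB -?big_split /=;
  apply: eq_bigr => l _; ring.
Qed.

Lemma vfY_linear1 (a : R) (f h : G -> R) x :
  (forall k, partial k h x = a * partial k f x) ->
  forall j, vfY L j h x = a * vfY L j f x.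
Proof.
move=> hh j.
rewrite (@vfY_linear 'I_1 (fun=> a) (fun=> f))/= ?big_ord1// => k.
by rewrite big_ord1.
Qed.

Lemma vfY_linear2 (a b : R) (f g h : G -> R) x :
  (forall k, partial k h x = a * partial k f x + b * partial k g x) ->
  forall j, vfY L j h x = a * vfY L j f x + b * vfY L j g x.
Proof.
move=> hh j.
rewrite (@vfY_linear bool (fun i => if i then a else b)
  (fun i => if i then f else g))/= ?big_bool//.
by move=> k; rewrite big_bool.
Qed.

Lemma partial_pow k a x : x != 0 ->
  partial k (fun y => NN y `^ a) x = a * NN x `^ (a - 1) * partial k NN x.
Proof.
move=> x0; rewrite {1}/partial.
have dN := derivableP (@derivable_gauge4 _ _ L x (delta_mx ord0 k)).
have h := is_derive_comp1 (is_derive1_powR a (gauge4_gt0 x0)) dN.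
by have [_ ->] := h.
Qed.

Lemma vfY_rho j x : x != 0 -> vfY L j (rho L) x = rho L x / (4 * NN x) * vfY L j NN x.
Proof.
move=> x0; apply: vfY_linear1 => k; rewrite (partial_pow _ _ x0).
have N0 := gauge4_gt0 x0.
rewrite powRB; last by apply/implyP => _; rewrite gt_eqF.
rewrite powRr1 ?ltW// rhoE; congr (_ * _).
by field; rewrite gt_eqF.
Qed.

Lemma hpair_rho f x : x != 0 -> hpair L (rho L) f x =
  rho L x / NN x * (dd x * euler f x + 4 * x ord0 ti * angular L f x).
Proof.
move=> x0; rewrite /hpair; under eq_bigr do rewrite vfY_rho// -mulrA.
rewrite -mulr_sumr -[X in _ * X]/(hpair L NN f x) hpair_gauge4//.
by field; rewrite gt_eqF// gauge4_gt0.
Qed.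

Lemma euler_gauge4 x : euler NN x = 4 * NN x.
Proof.
rewrite /euler; under eq_bigr do rewrite !partial_gauge4 partial_horiz_sq_x partial_horiz_sq_y
  ![ti == _]eq_sym xi_ti yi_ti.
rewrite partial_gauge4 partial_horiz_sq_t eqxx /gauge4.
have -> : \sum_(i < n) (x ord0 (xi i) *
   (2 * dd x * (4 * `|L i| * x ord0 (xi i)) + 32 * x ord0 ti * false%:R) +
   x ord0 (yi i) *
   (2 * dd x * (4 * `|L i| * x ord0 (yi i)) + 32 * x ord0 ti * false%:R)) =
   4 * dd x * dd x.
  rewrite [X in _ = _ * X]/horiz_sq -big_split/= mulr_sumr; apply: eq_bigr => i _.
  rewrite mulr0n; ring.
rewrite mulr1n; ring.
Qed.

Lemma angular_gauge4 x : angular L NN x = 0.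
Proof.
rewrite /angular big1// => i _; rewrite !partial_gauge4 partial_horiz_sq_x partial_horiz_sq_y.
rewrite ![ti == _]eq_sym xi_ti yi_ti mulr0n; ring.
Qed.

Lemma euler_horiz_sq x : euler dd x = 2 * dd x.
Proof.
rewrite /euler partial_horiz_sq_t mulr0 addr0 [X in _ = _ * X]/horiz_sq -big_split/= mulr_sumr.
by apply: eq_bigr => i _; rewrite partial_horiz_sq_x partial_horiz_sq_y; ring.
Qed.

Lemma angular_horiz_sq x : angular L dd x = 0.
Proof.
by rewrite /angular big1// => i _; rewrite partial_horiz_sq_x partial_horiz_sq_y; ring.
Qed.

(** By homogeneity, [euler] multiplies NN by 4, while [angular] kills it. *)
Lemma hgrad_rho2 x : x != 0 -> hpair L (rho L) (rho L) x = dd x / rho L x ^+ 2.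
Proof.
move=> x0; have r0 := rho_gt0 x0.
have -> : hpair L (rho L) (rho L) x = rho L x / (4 * NN x) * hpair L (rho L) NN x.
  rewrite /hpair mulr_sumr; apply: eq_bigr => j _.
  by rewrite {2}(vfY_rho j x0) mulrCA.
rewrite hpair_rho// euler_gauge4 angular_gauge4 -rho4; field.
by rewrite gt_eqF.
Qed.

(** Since sum_j (Y_j rho) Y_i (Y_j rho) is half of Y_i applied to |grad rho|^2, the
    infinity-Laplacian is half of the derivative of |grad rho|^2 = d / rho^2 along
    the gradient of rho. By [hpair_rho] the derivatives of d and of rho along that
    gradient are 2 d^2 / rho^3 and d / rho^2, and the two contributions cancel. *)
Lemma inf_laplacian_rho x : x != 0 -> inf_laplacian L (rho L) x = 0.
Proof.
move=> x0; pose h y := \sum_j vfY L j (rho L) y ^+ 2.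
have rho_elem : elem (rho L) by exact: (elem_pow 4^-1).
have dY j k : derivable (vfY L j (rho L)) x (delta_mx ord0 k).
  have [g eg hg] := elem_vfY j rho_elem.
  have [dg _ /(_ x x0)[+ _]] := elem_is_derive k eg.
  apply: near_eq_derivable.
  by near=> y; rewrite hg//; near: y; exact: near_neq0.
have hY i : vfY L i h x = \sum_j 2 * vfY L j (rho L) x * vfY L i (vfY L j (rho L)) x.
  apply: (@vfY_linear _ (fun j => 2 * vfY L j (rho L) x)) => k.
  have -> : h = \sum_j (vfY L j (rho L)) ^+ 2 by apply/funext => y; rewrite fct_sumE.
  rewrite /partial derive_sum => [|j]; last exact: derivableX.
  by apply: eq_bigr => j _; rewrite deriveX// expr1.
have -> : inf_laplacian L (rho L) x = 2^-1 * hpair L (rho L) h x.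
  rewrite /inf_laplacian /hpair mulr_sumr; apply: eq_bigr => i _.
  rewrite hY !mulr_sumr; apply: eq_bigr => j _.
  move: (vfY L i _ x) (vfY L j _ x) (vfY L i _ x) => a b c; by field.
pose q y := dd y * NN y `^ (- 2^-1).
have rho2 y : NN y `^ (- 2^-1) = (rho L y ^+ 2)^-1.
  by rewrite powRN rhoE -powR_mulrn ?powR_ge0// -powRrM; congr (_ `^ _)^-1; field.
have hq : \forall y \near x, h y = q y.
  near=> y; have y0 : y != 0 by near: y; exact: near_neq0.
  by rewrite /q rho2 -hgrad_rho2//; apply: eq_bigr => j _; rewrite expr2.
have -> : hpair L (rho L) h x =
    (rho L x ^+ 2)^-1 * hpair L (rho L) dd x +
    (- 2^-1 * dd x / (rho L x ^+ 2 * NN x)) * hpair L (rho L) NN x.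
  rewrite /hpair !mulr_sumr -big_split/=; apply: eq_bigr => j _.
  rewrite (near_vfY _ hq) (@vfY_linear2 (rho L x ^+ 2)^-1
    (- 2^-1 * dd x / (rho L x ^+ 2 * NN x)) dd NN q);
    first by rewrite mulrDr; congr (_ + _); exact: mulrCA.
  move=> k; have dN := derivableP (@derivable_gauge4 _ _ L x (delta_mx ord0 k)).
  have dp := is_derive_comp1 (is_derive1_powR (- 2^-1) (gauge4_gt0 x0)) dN.
  have dD := derivableP (@derivable_horiz_sq _ _ L x (delta_mx ord0 k)).
  have [_ E] := is_deriveM dD dp; rewrite [LHS]E {E} /GRing.scale /=.
  rewrite powRB; last by apply/implyP => _; rewrite gt_eqF// gauge4_gt0.
  rewrite powRr1 ?gauge4_ge0// rho2 /partial.
  have := gauge4_gt0 x0; have := rho_gt0 x0.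
  move: (rho L x) (NN x) ('D__ dd x) ('D__ NN x) => r N a b r0 N0.
  by field; rewrite !gt_eqF.
rewrite !hpair_rho// euler_gauge4 angular_gauge4 euler_horiz_sq angular_horiz_sq.
have := gauge4_gt0 x0; have := rho_gt0 x0.
move: (rho L x) (NN x) => r N r0 N0; by field; rewrite !gt_eqF.
Unshelve. all: by end_near. Qed.

End gauge.

(** * Dilations and polar coordinates *)

Section polar.
Context {R : realType} {n : nat} (L : 'I_n -> R).
Local Notation G := 'rV[R]_(n + n + 1).
Local Notation ti := (@tidx n).
Local Notation dd := (horiz_sq L).
Local Notation NN := (gauge4 L).
Local Notation mu := (@lebesgue_rV R (n + n + 1)).
Local Notation lambda := (@lebesgue_measure R).
Local Notation Q := (@homdim R n).
Hypothesis L0 : forall i, L i != 0.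

Lemma integral_powR_tail (r q : R) : 0 < r -> 1 <= q ->
  (\int[lambda]_(s in `]r, +oo[) (q * s `^ (- q - 1))%:E = (r `^ (- q))%:E)%E.
Proof.
move=> r0 q1.
have q0 : 0 < q by apply: lt_le_trans q1.
have dP (a s : R) : 0 < s -> is_derive s 1 (fun z : R => z `^ a) (a * s `^ (a - 1)).
  by move=> s0; exact: is_derive1_powR.
have cP (a s : R) : 0 < s -> {for s, continuous (fun z : R => z `^ a)}.
  move=> s0; apply/differentiable_continuous/derivable1_diffP.
  by have [] := dP a s s0.
rewrite integral_itv_obnd_cbnd; last first.
  apply/measurable_EFinP/measurable_funM => //.
  by apply: measurable_funTS; exact: measurable_powR.
rewrite (@ge0_continuous_FTC2y _ _ (fun s => - s `^ (- q)) r 0).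
- by rewrite EFinN oppeK add0e.
- by move=> s rs; rewrite mulr_ge0 ?powR_ge0// ltW.
- apply: continuous_in_subspaceT => s /set_mem /=; rewrite in_itv/= andbT => rs.
  have cs := cP (- q - 1) s (lt_le_trans r0 rs).
  exact: (continuousM (@cst_continuous _ _ q s) cs).
- rewrite -oppr0; apply: cvgN; apply/cvgrPdist_le => e e0; near=> s.
  have s1 : 1 <= s by near: s; apply: nbhs_pinfty_ge; exact: num_real.
  have se : e^-1 <= s by near: s; apply: nbhs_pinfty_ge; exact: num_real.
  rewrite sub0r normrN ger0_norm ?powR_ge0//.
  apply: (@le_trans _ _ (s `^ (- 1))); first by rewrite ler_powR// lerN2.
  by rewrite powR_inv1 ?(le_trans ler01)// invf_ple ?posrE// (lt_le_trans ltr01).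
- move=> s rs; apply: derivableN.
  by have [] := dP (- q) s (lt_trans r0 rs).
- apply: cvg_at_right_filter; apply: cvgN.
  exact: cP.
- move=> s; rewrite in_itv/= andbT => rs.
  have s0 := lt_trans r0 rs.
  rewrite derive1E deriveN; last by have [] := dP (- q) s s0.
  by have [_ ->] := dP (- q) s s0; rewrite mulNr opprK.
Unshelve. all: by end_near. Qed.

Definition dil_weight (s : R) (k : 'I_(n + n + 1)) : R :=
  if k == ti then s ^+ 2 else s.

Definition dil (s : R) (x : G) : G := scale_rV (dil_weight s) x.

Lemma dil_xi s x i : dil s x ord0 (xi i) = s * x ord0 (xi i).
Proof. by rewrite mxE /dil_weight xi_ti. Qed.

Lemma dil_yi s x i : dil s x ord0 (yi i) = s * x ord0 (yi i).
Proof. by rewrite mxE /dil_weight yi_ti. Qed.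

Lemma dil_ti s x : dil s x ord0 ti = s ^+ 2 * x ord0 ti.
Proof. by rewrite mxE /dil_weight eqxx. Qed.

Lemma horiz_sq_dil s x : dd (dil s x) = s ^+ 2 * dd x.
Proof.
rewrite /horiz_sq mulrDr !mulr_sumr; congr (_ + _); apply: eq_bigr => i _.
  rewrite dil_xi; ring.
rewrite dil_yi; ring.
Qed.

Lemma gauge4_dil s x : NN (dil s x) = s ^+ 4 * NN x.
Proof. rewrite /gauge4 horiz_sq_dil dil_ti; ring. Qed.

Lemma rho_dil s x : 0 <= s -> rho L (dil s x) = s * rho L x.
Proof.
move=> s0; rewrite !rhoE gauge4_dil powRM ?gauge4_ge0 ?exprn_ge0//; congr (_ * _).
by rewrite -powR_mulrn// -powRrM mulfV// powRr1.
Qed.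

(** The Jacobian of a dilation; its exponent is the homogeneous dimension. *)
Lemma prod_dil_weight s : \prod_k dil_weight s k = s ^+ (2 * n + 2).
Proof.
rewrite big_split_ord/= big_ord1 /dil_weight eqxx exprD; congr (_ * _).
under eq_bigr do rewrite eq_lrshift.
by rewrite prodr_const card_ord mul2n addnn.
Qed.

Lemma ge0_integral_dil (s : R) (f : G -> \bar R) : 0 < s ->
  measurable_fun [set: G] f -> (forall x, 0 <= f x)%E ->
  (\int[mu]_x f (dil s x) = (s `^ (- Q))%:E * \int[mu]_x f x)%E.
Proof.
move=> s0 mf f0.
have c0 : 0 <= s ^+ (2 * n + 2) by rewrite exprn_ge0// ltW.
have w0 k : 0 < dil_weight s k by rewrite /dil_weight; case: ifP => //; rewrite exprn_gt0.
have := @ge0_integral_rV_transfer R _ (dil s) (NngNum c0) (measurable_scale_rV _)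
  (lebesgue_rV_scale w0 (c := NngNum c0) (esym (prod_dil_weight s))) f mf f0.
move=> ->; rewrite muleA -EFinM powRN /homdim powR_mulrn ?ltW//=.
by rewrite mulVf ?mul1e// gt_eqF// exprn_gt0.
Qed.

Lemma measurable_horiz_sq : measurable_fun [set: G] dd.
Proof. apply: continuous_measurable_rV; exact: horiz_sq_continuous. Qed.

Lemma measurable_rho : measurable_fun [set: G] (rho L).
Proof.
apply: (@measurableT_comp _ _ _ _ _ _ (fun z : R => z `^ 4^-1)).
  exact: measurable_powR.
apply: continuous_measurable_rV; exact: gauge4_continuous.
Qed.

Lemma measurable_dil2 :
  measurable_fun [set: G * measurableTypeR R] (fun z => dil z.2 z.1).
Proof.
apply: measurable_fun_coordP => k; under eq_fun do rewrite mxE.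
apply: measurable_funM.
  have m2 := @measurable_snd _ _ G (measurableTypeR R).
  by rewrite /dil_weight; case: (k == ti) => //; exact: (measurable_funM m2 m2).
exact: (measurableT_comp (measurable_coord k)).
Qed.

Local Notation Rpos := (`]0%R, +oo[%classic : set R).

(** The origin is removed so that polar coordinates hold pointwise: its orbit is
    a point, where the weight rho^(-Q) has no meaning. *)
Definition punctured_ball : set G := [set x | 0 < rho L x < 1].

Lemma measurable_pball : measurable punctured_ball.
Proof.
rewrite -[punctured_ball]setTI; have -> : punctured_ball = rho L @^-1` `]0, 1[%classic.
  by apply/seteqP; split => x /=; rewrite in_itv.
exact: measurable_rho.
Qed.

(** Polar coordinates for the dilations. For fixed s > 0 the dilation turns the
    integral over the unit ball into s^(-Q) times the integral over rho < s; then
    the order of integration is exchanged and s^(-Q-1) is integrated over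
    s > rho. *)
Lemma ge0_polar (h : G -> R) : measurable_fun [set: G] h -> (forall x, 0 <= h x) ->
  (\int[mu]_(x in punctured_ball) \int[lambda]_(s in Rpos) (h (dil s x) * s `^ (- 1))%:E =
   \int[mu]_x (h x * (Q^-1 * rho L x `^ (- Q)))%:E)%E.
Proof.
move=> mh h0.
pose F (z : G * measurableTypeR R) : R :=
  h (dil z.2 z.1) * z.2 `^ (- 1) * \1_punctured_ball z.1 * \1_Rpos z.2.
pose F' (z : G * measurableTypeR R) : R :=
  h z.1 * (\1_Rpos (rho L z.1) * (\1_Rpos (z.2 - rho L z.1) * z.2 `^ (- Q - 1))).
have ind0 (T : Type) (A : set T) x : 0 <= \1_A x :> R by rewrite indicE.
have F0 z : (0 <= (EFin \o F) z)%E by rewrite lee_fin !mulr_ge0// powR_ge0.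
have F'0 z : (0 <= (EFin \o F') z)%E by rewrite lee_fin !mulr_ge0// powR_ge0.
have msnd : measurable_fun [set: G * measurableTypeR R] (snd : _ -> measurableTypeR R).
  exact: measurable_snd.
have mfst : measurable_fun [set: G * measurableTypeR R] (fst : _ -> G).
  exact: measurable_fst.
have mF : measurable_fun [set: G * measurableTypeR R] (EFin \o F).
  apply/measurable_EFinP; apply: measurable_funM; last first.
    by apply: (measurableT_comp _ msnd); exact: measurable_indic.
  apply: measurable_funM; last first.
    apply: (measurableT_comp _ mfst); apply: measurable_indic; exact: measurable_pball.
  apply: measurable_funM; first exact: (measurableT_comp mh measurable_dil2).
  exact: (measurableT_comp (@measurable_powR R _) msnd).
have mrho1 : measurable_fun [set: G * measurableTypeR R] (fun z => rho L z.1).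
  exact: (measurableT_comp measurable_rho mfst).
have mpos : measurable_fun setT (\1_Rpos : measurableTypeR R -> R).
  exact: measurable_indic.
have mF' : measurable_fun [set: G * measurableTypeR R] (EFin \o F').
  apply/measurable_EFinP; apply: measurable_funM.
    exact: (measurableT_comp mh mfst).
  apply: measurable_funM.
    exact: (measurableT_comp mpos mrho1).
  apply: measurable_funM; last first.
    exact: (measurableT_comp (@measurable_powR R _) msnd).
  exact: (measurableT_comp mpos (measurable_funB msnd mrho1)).
have posE (r : R) : \1_Rpos r = (0 < r)%R%:R :> R.
  by rewrite indicE; congr (nat_of_bool _)%:R; apply/idP/idP; rewrite in_setE /= in_itv /= andbT.
have ballE x : \1_punctured_ball x = (0 < rho L x)%R%:R * (rho L x < 1)%R%:R :> R.
  rewrite indicE -natrM mulnb; congr (nat_of_bool _)%:R.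
  by apply/idP/idP; rewrite in_setE.
have bool2 (b : bool) : b%:R = 0 :> R \/ b%:R = 1 :> R by case: b; [right|left].
transitivity (\int[mu]_x \int[lambda]_s (F (x, s))%:E)%E.
  rewrite integral_mkcond; apply: eq_integral => x _.
  rewrite patchE; case: ifPn => xB; last first.
    rewrite integral0_eq// => s _.
    by rewrite /F /= indicE (negbTE xB) mulr0 mul0r.
  rewrite integral_mkcond; apply: eq_integral => s _.
  rewrite patchE /F /= !indicE xB mulr1; case: ifPn => sB.
    by rewrite mulr1.
  by rewrite mulr0.
rewrite (fubini_tonelli _ mF F0).
transitivity (\int[lambda]_s \int[mu]_x (F' (x, s))%:E)%E.
  apply: eq_integral => s _.
  have [s0|s0] := ltP 0 s; last first.
    rewrite !integral0_eq// => x _.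
      rewrite /F' /= !posE subr_gt0.
      have [r0|_] := ltP 0 (rho L x); last by rewrite mul0r mulr0.
      by rewrite ltNge (le_trans s0 (ltW r0))/= mul0r !mulr0.
    by rewrite /F /= posE ltNge s0/= mulr0.
  pose g x := (h x * (\1_Rpos (rho L x) * \1_Rpos (s - rho L x)))%:E.
  have g0 x : (0 <= g x)%E by rewrite lee_fin !mulr_ge0.
  have mg : measurable_fun [set: G] g.
    apply/measurable_EFinP; apply: measurable_funM => //.
    apply: measurable_funM; first exact: (measurableT_comp mpos measurable_rho).
    have mB := measurable_funB (@measurable_cst _ _ G _ setT s) measurable_rho.
    exact: (measurableT_comp mpos mB).
  transitivity (\int[mu]_x ((s `^ (- 1))%:E * g (dil s x)))%E.
    apply: eq_integral => x _; rewrite /g -EFinM; congr EFin.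
    rewrite rho_dil ?ltW// /F /= ballE !posE s0 mulr1.
    rewrite pmulr_rgt0// -[X in X - _]mulr1 -mulrBr pmulr_rgt0// subr_gt0.
    ring.
  rewrite ge0_integralZl//; last 2 first.
  - exact: (measurableT_comp mg (measurable_scale_rV _)).
  - by rewrite lee_fin powR_ge0.
  rewrite ge0_integral_dil// muleA -EFinM -powRD; last by apply/implyP => _; rewrite gt_eqF.
  rewrite -ge0_integralZl//; last by rewrite lee_fin powR_ge0.
  apply: eq_integral => x _; rewrite /g /F' -EFinM /=; congr EFin.
  by rewrite [- 1 + _]addrC; ring.
rewrite -(fubini_tonelli _ mF' F'0).
have Q0 : 0 < Q by rewrite ltr0n addn2.
apply: eq_integral => x _.
have [r0|r0] := ltP 0 (rho L x); last first.
  have -> : rho L x = 0 by apply/eqP; rewrite eq_le r0 rho_ge0.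
  rewrite powR0 ?oppr_eq0 ?gt_eqF// !mulr0 integral0_eq// => s _.
  by rewrite /F' /= !posE ltNge r0 mul0r mulr0.
pose f s := (Q * s `^ (- Q - 1))%:E.
transitivity (\int[lambda]_s ((h x / Q)%:E * (f \_ `]rho L x, +oo[%classic) s))%E.
  apply: eq_integral => s _; rewrite /F' /= !posE r0 mul1r subr_gt0 patchE.
  have -> : (s \in `]rho L x, +oo[%classic) = (rho L x < s).
    by apply/idP/idP; rewrite in_setE /= in_itv /= andbT.
  case: ifP => _; last by rewrite mul0r mulr0 mule0.
  by rewrite mul1r /f -EFinM; congr EFin; field; rewrite gt_eqF.
have mf : measurable_fun setT f.
  by apply/measurable_EFinP/measurable_funM => //; exact: measurable_powR.
have f0 s : (0 <= f s)%E by rewrite lee_fin mulr_ge0 ?powR_ge0// ltW.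
rewrite ge0_integralZl//; first last.
- by rewrite lee_fin divr_ge0// ltW.
- by move=> s _; apply: erestrict_ge0.
- by apply/(measurable_restrictT _ _).1 => //; exact: measurable_funTS.
rewrite -integral_mkcond integral_powR_tail//; last by rewrite ler1n addn2.
by rewrite -EFinM mulrA.
Qed.

End polar.

(** * Integrability near the origin and signed polar coordinates *)

Section radial.
Context {R : realType} {n : nat} (L : 'I_n -> R).
Local Notation G := 'rV[R]_(n + n + 1).
Local Notation ti := (@tidx n).
Local Notation dd := (horiz_sq L).
Local Notation mu := (@lebesgue_rV R (n + n + 1)).
Local Notation lambda := (@lebesgue_measure R).
Local Notation Q := (@homdim R n).
Local Notation Rpos := (`]0%R, +oo[%classic : set R).
Local Notation pball := (punctured_ball L).
Hypothesis L0 : forall i, L i != 0.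

(** A constant c with |x_j| <= c sqrt(d) for all horizontal coordinates. *)
Definition coord_const : R := 1 + \sum_i (2 * `|L i|)^-1.

Lemma coord_cst_ge1 : 1 <= coord_const.
Proof. by rewrite lerDl sumr_ge0// => i _; rewrite invr_ge0 mulr_ge0. Qed.

Lemma sqr_le_horiz_sq (i : 'I_n) (a d : R) : 0 <= d -> 2 * `|L i| * a ^+ 2 <= d ->
  `|a| <= coord_const * Num.sqrt d.
Proof.
move=> d0 ad; have K1 := coord_cst_ge1; have K0 := le_trans ler01 K1.
have l0 : 0 < 2 * `|L i| by rewrite mulr_gt0// normr_gt0.
rewrite -(@ler_pXn2r _ 2)//; last exact: mulr_ge0 (sqrtr_ge0 _).
rewrite real_normK ?num_real// exprMn sqr_sqrtr//.
apply: (@le_trans _ _ ((2 * `|L i|)^-1 * d)).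
  by rewrite ler_pdivlMl.
rewrite ler_wpM2r//; apply: (@le_trans _ _ coord_const).
  rewrite /coord_const (bigD1 i)//= addrCA lerDl addr_ge0// sumr_ge0// => j _;
  by rewrite invr_ge0 mulr_ge0.
by rewrite expr2 ler_peMl.
Qed.

Lemma sqrt_horiz_sq_le_rho x : Num.sqrt (dd x) <= rho L x.
Proof.
rewrite -(ger0_norm (rho_ge0 L x)) -sqrtr_sqr ler_wsqrtr//.
exact: horiz_sq_le_rho.
Qed.

Lemma coord_le_sqrt_x (i : 'I_n) (x : G) : `|x ord0 (xi i)| <= coord_const * Num.sqrt (dd x).
Proof. exact: (sqr_le_horiz_sq (horiz_sq_ge0 L x) (horiz_sq_ge_x L i x)). Qed.

Lemma coord_le_sqrt_y (i : 'I_n) (x : G) : `|x ord0 (yi i)| <= coord_const * Num.sqrt (dd x).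
Proof. exact: (sqr_le_horiz_sq (horiz_sq_ge0 L x) (horiz_sq_ge_y L i x)). Qed.

Lemma mu_pball_lty : (mu pball < +oo)%E.
Proof.
have K1 := coord_cst_ge1.
pose A (k : 'I_(n + n + 1)) := `[- coord_const, coord_const]%classic.
have mA k : measurable (A k) by exact: measurable_itv.
apply: (@le_lt_trans _ _ (mu (box A))).
  apply: le_measure.
  - by apply/mem_set; exact: measurable_pball.
  - by apply/mem_set; exact: measurable_box.
  move=> x /= /andP[r0 r1]; apply: index_cases => [i|i|]; rewrite /A /mkset /= in_itv/= -ler_norml.
  - apply: le_trans (coord_le_sqrt_x i x) _; rewrite ler_piMr ?(le_trans ler01)//.
    by rewrite (le_trans (sqrt_horiz_sq_le_rho x))// ltW.
  - apply: le_trans (coord_le_sqrt_y i x) _; rewrite ler_piMr ?(le_trans ler01)//.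
    by rewrite (le_trans (sqrt_horiz_sq_le_rho x))// ltW.
  - apply: (le_trans _ K1); have := t_le_rho L x.
    have : rho L x ^+ 2 <= 1 by rewrite expr_le1 ?ltW.
    have := normr_ge0 (x ord0 ti); lra.
rewrite (lebesgue_rV_box mA) ltey_eq prode_fin_num// => k _.
by rewrite lebesgue_measure_itv/=; case: ifP.
Qed.

(** All integrands below are dominated by a multiple of this function. *)
Definition radial_kernel (M : R) (x : G) : R := rho L x `^ (1 - Q) * (rho L x <= M)%R%:R.

Lemma ker_ge0 M x : 0 <= radial_kernel M x.
Proof. by rewrite mulr_ge0// powR_ge0. Qed.

Lemma Q_ge2 : 2 <= Q.
Proof. by rewrite /homdim ler_nat addnC leq_addr. Qed.

Lemma measurable_le_rho M : measurable_fun [set: G] (fun x => (rho L x <= M)%R%:R : R).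
Proof.
have -> : (fun x : G => (rho L x <= M)%R%:R : R) =
    (\1_(`]-oo, M]%classic : set R) : R -> R) \o rho L.
  apply/funext => x /=; rewrite indicE; congr (nat_of_bool _)%:R.
  by apply/idP/idP; rewrite in_setE /= in_itv /=.
apply: measurableT_comp; last exact: measurable_rho.
by apply: measurable_indic; exact: measurable_itv.
Qed.

Lemma measurable_rho_pow a : measurable_fun [set: G] (fun x => rho L x `^ a).
Proof. exact: (measurableT_comp (@measurable_powR R a) (measurable_rho L)). Qed.

Lemma measurable_ker M : measurable_fun [set: G] (radial_kernel M).
Proof. exact: measurable_funM (measurable_rho_pow _) (measurable_le_rho M). Qed.

(** Along the orbit of x the function rho 1_(rho <= M), divided by s, is the constant
    rho(x) on an interval of length M / rho(x). *)
Lemma orbit_integral (r M : R) : 0 < r -> 0 < M ->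
  (\int[lambda]_(s in Rpos) (r * (s * r <= M)%R%:R)%:E = M%:E)%E.
Proof.
move=> r0 M0.
transitivity (\int[lambda]_(s in Rpos) (r%:E * (\1_(`]-oo, M / r]%classic : set R) s)%:E))%E.
  apply: eq_integral => s _; rewrite -EFinM indicE; congr (_ * _)%:E.
  rewrite -ler_pdivlMr//; congr (nat_of_bool _)%:R.
  by apply/idP/idP; rewrite in_setE /= in_itv /=.
rewrite ge0_integralZl//; last 2 first.
- by apply/measurable_EFinP; apply: measurable_indic; exact: measurable_itv.
- by rewrite lee_fin ltW.
rewrite integral_indic; [|by []|exact: measurable_itv].
have -> : (`]-oo, M / r]%classic : set R) `&` Rpos = (`]0%R, M / r]%classic : set R).
  by apply/seteqP; split => s /=; rewrite !in_itv/= andbT;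
    [move=> [-> ->]|move=> /andP[-> ->]].
rewrite [X in (_ * X)%E](@lebesgue_measure_itv R `]0%R, M / r]).
rewrite /= lte_fin divr_gt0// sube0 -EFinM mulrC divfK//.
by rewrite gt_eqF.
Qed.

(** Polar coordinates applied to the function rho 1_(rho <= M). *)
Lemma integrable_ker M : 0 < M -> mu.-integrable [set: G] (EFin \o radial_kernel M).
Proof.
move=> M0; apply/integrableP; split; first by apply/measurable_EFinP; exact: measurable_ker.
pose h (x : G) := rho L x * (rho L x <= M)%R%:R.
have h0 x : 0 <= h x by rewrite mulr_ge0// rho_ge0.
have mh : measurable_fun [set: G] h.
  exact: measurable_funM (measurable_rho L) (measurable_le_rho M).
have Q0 : 0 < Q by apply: lt_le_trans Q_ge2.
have E : (\int[mu]_x (h x * (Q^-1 * rho L x `^ (- Q)))%:E = M%:E * mu pball)%E.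
  rewrite -ge0_polar// -integral_cst; last exact: measurable_pball.
  apply: eq_integral => x /set_mem /= /andP[r0 r1].
  rewrite -(orbit_integral r0 M0); apply: eq_integral => s.
  rewrite in_setE /= in_itv /= andbT => s0; congr EFin.
  have s0w := ltW s0; rewrite /h rho_dil// powR_inv1//; field; by rewrite gt_eqF.
have kE x : (`|(EFin \o radial_kernel M) x| = Q%:E * (h x * (Q^-1 * rho L x `^ (- Q)))%:E)%E.
  rewrite /= ger0_norm ?ker_ge0// -EFinM; congr EFin.
  rewrite /radial_kernel /h; have [->|r0] := eqVneq (rho L x) 0.
    have Q1 : 1 - Q != 0 by rewrite subr_eq0 lt_eqF// (lt_le_trans _ Q_ge2)// ltr1n.
    by rewrite powR0// !mul0r mulr0.
  rewrite powRD ?r0 ?implybT// powRr1 ?rho_ge0//.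
  by field; rewrite gt_eqF.
under eq_integral do rewrite kE.
rewrite ge0_integralZl//.
- by rewrite E muleA -EFinM lte_mul_pinfty ?mu_pball_lty// lee_fin mulr_ge0 ?ltW.
- apply/measurable_EFinP/measurable_funM => //; apply: measurable_funM => //.
  exact: measurable_rho_pow.
- by move=> x _; rewrite lee_fin mulr_ge0// mulr_ge0 ?powR_ge0// invr_ge0 ltW.
- by rewrite lee_fin ltW.
Qed.

Lemma integrable_le_ker M C (f : G -> R) : 0 < M -> measurable_fun [set: G] f ->
  (forall x, `|f x| <= C * radial_kernel M x) -> mu.-integrable [set: G] (EFin \o f).
Proof.
move=> M0 mf fC.
apply: (@le_integrable _ _ _ _ _ _ _ (fun x => (C%:E * (EFin \o radial_kernel M) x)%E)) => //.
- exact/measurable_EFinP.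
- move=> x _; rewrite [X in (_ <= `|X|)%E](_ : _ = (C * radial_kernel M x)%:E)//.
  by rewrite /= lee_fin (le_trans (fC x))// ler_norm.
- by apply: integrableZl => //; exact: integrable_ker.
Qed.

(** Applied to the positive and negative parts of f. The uniform bound on the
    orbit integrals of |f| makes all these integrals finite, the unit ball having
    finite measure. *)
Lemma polar (f : G -> R) (C : R) : measurable_fun [set: G] f ->
  (forall x, pball x ->
    (\int[lambda]_(s in Rpos) (`|f (dil s x)| * s `^ (- 1))%:E <= C%:E)%E) ->
  (\int[mu]_x (f x * (Q^-1 * rho L x `^ (- Q)))%:E =
   \int[mu]_(x in pball) \int[lambda]_(s in Rpos) (f (dil s x) * s `^ (- 1))%:E)%E.
Proof.
move=> mf fC.
have Q0 : 0 < Q by apply: lt_le_trans Q_ge2.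
have k0 x : 0 <= Q^-1 * rho L x `^ (- Q) by rewrite mulr_ge0 ?powR_ge0// invr_ge0 ltW.
have mk : measurable_fun [set: G] (fun x => Q^-1 * rho L x `^ (- Q)).
  by apply: measurable_funM => //; exact: measurable_rho_pow.
have key (h : G -> R) : measurable_fun [set: G] h -> (forall x, 0 <= h x) ->
    (forall x, h x <= `|f x|) ->
  [/\ forall x, pball x -> lambda.-integrable Rpos (fun s => (h (dil s x) * s `^ (- 1))%:E),
      mu.-integrable pball
        (fun x => \int[lambda]_(s in Rpos) (h (dil s x) * s `^ (- 1))%:E)%E &
      mu.-integrable [set: G] (fun x => (h x * (Q^-1 * rho L x `^ (- Q)))%:E)].
  move=> mh h0 hf.
  have mh2 : measurable_fun [set: G * measurableTypeR R]
      (fun z => h (dil z.2 z.1) * z.2 `^ (- 1)).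
    apply: measurable_funM; first exact: (measurableT_comp mh measurable_dil2).
    exact: (measurableT_comp (@measurable_powR R _) measurable_snd).
  have mhs (g : G -> R) x : measurable_fun [set: G] g ->
      measurable_fun [set: measurableTypeR R] (fun s => g (dil s x) * s `^ (- 1)).
    move=> mg; apply: measurable_funM; last exact: measurable_powR.
    exact: (measurableT_comp mg (measurableT_comp measurable_dil2 (pair1_measurable x))).
  have hs0 x s : (0 <= (h (dil s x) * s `^ (- 1))%:E)%E by rewrite lee_fin mulr_ge0 ?powR_ge0.
  have hC x : pball x ->
      (\int[lambda]_(s in Rpos) (h (dil s x) * s `^ (- 1))%:E <= C%:E)%E.
    move=> xB; apply: (le_trans _ (fC x xB)); apply: ge0_le_integral => //.
    - by apply/measurable_EFinP; apply: measurable_funTS; exact: mhs.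
    - apply/measurable_EFinP; apply: measurable_funTS; apply: (mhs (fun y => `|f y|)).
      exact: measurableT_comp.
    - by move=> s _; rewrite lee_fin ler_wpM2r ?powR_ge0.
  have I1 x : pball x -> lambda.-integrable Rpos (fun s => (h (dil s x) * s `^ (- 1))%:E).
    move=> xB; apply/integrableP; split.
      by apply/measurable_EFinP; apply: measurable_funTS; exact: mhs.
    under eq_integral do rewrite gee0_abs//.
    exact: le_lt_trans (hC x xB) (ltry _).
  have I0 x : (0 <= \int[lambda]_(s in Rpos) (h (dil s x) * s `^ (- 1))%:E)%E.
    exact: integral_ge0.
  have mI : measurable_fun [set: G]
      (fun x => \int[lambda]_(s in Rpos) (h (dil s x) * s `^ (- 1))%:E)%E.
    pose F (z : G * measurableTypeR R) :=
      (h (dil z.2 z.1) * z.2 `^ (- 1) * \1_Rpos z.2)%:E.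
    have mpos : measurable_fun setT (\1_Rpos : measurableTypeR R -> R).
      exact: measurable_indic.
    have mF : measurable_fun [set: G * measurableTypeR R] F.
      apply/measurable_EFinP; apply: measurable_funM => //.
      exact: (measurableT_comp mpos measurable_snd).
    have F0 z : (0 <= F z)%E.
      by rewrite lee_fin !mulr_ge0 ?powR_ge0// indicE.
    rewrite (_ : (fun x : G => _) = fubini_F lambda F).
      exact: measurable_fun_fubini_tonelli_F.
    apply/funext => x; rewrite /fubini_F [LHS]integral_mkcond.
    apply: eq_integral => s _; rewrite patchE /F /= indicE.
    by case: ifP => _; rewrite ?mulr1 ?mulr0.
  have I2 : mu.-integrable pball
      (fun x => \int[lambda]_(s in Rpos) (h (dil s x) * s `^ (- 1))%:E)%E.
    apply/integrableP; split; first exact: measurable_funTS.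
    under eq_integral do rewrite gee0_abs//.
    apply: (@le_lt_trans _ _ (\int[mu]_(x in pball) (cst C%:E x))%E).
      apply: ge0_le_integral => //.
      - exact: measurable_pball.
      - exact: measurable_funTS.
    rewrite integral_cst; last exact: measurable_pball.
    have fB : mu pball \is a fin_num by rewrite ge0_fin_numE ?mu_pball_lty.
    by rewrite -[X in (_ * X)%E](fineK fB) -EFinM ltry.
  split => //; apply/integrableP; split.
    by apply/measurable_EFinP; exact: measurable_funM.
  have /integrableP[_] := I2.
  under eq_integral do rewrite gee0_abs//.
  rewrite ge0_polar//; apply: le_lt_trans.
  rewrite le_eqVlt; apply/orP; left; apply/eqP; apply: eq_integral => x _.
  by rewrite gee0_abs// lee_fin mulr_ge0.
have mabs : measurable_fun [set: G] (fun x => `|f x|) by exact: measurableT_comp.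
pose P x := (`|f x| + f x) / 2; pose N x := (`|f x| - f x) / 2.
have mP : measurable_fun [set: G] P.
  by apply: measurable_funM => //; exact: measurable_funD.
have mN : measurable_fun [set: G] N.
  by apply: measurable_funM => //; exact: measurable_funB.
have absf x : - `|f x| <= f x <= `|f x| by rewrite -ler_norml.
have P0 x : 0 <= P x by have /andP[] := absf x; rewrite /P; lra.
have N0 x : 0 <= N x by have /andP[] := absf x; rewrite /N; lra.
have Pf x : P x <= `|f x| by have /andP[] := absf x; rewrite /P; lra.
have Nf x : N x <= `|f x| by have /andP[] := absf x; rewrite /N; lra.
have fE x : f x = P x - N x by rewrite /P /N; lra.
have [P1 P2 P3] := key P mP P0 Pf; have [N1 N2 N3] := key N mN N0 Nf.
under eq_integral do rewrite fE mulrBl EFinB.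
rewrite integralB//.
rewrite -!ge0_polar// -integralB//; last exact: measurable_pball.
apply: eq_integral => x /set_mem xB; rewrite -integralB//; [|exact: P1|exact: N1].
by apply: eq_integral => s _; rewrite /= fE mulrBl EFinB.
Qed.

End radial.

(** * Test functions along dilation orbits *)

Section test_functions.
Context {R : realType} {n : nat} (L : 'I_n -> R).
Local Notation G := 'rV[R]_(n + n + 1).
Local Notation ti := (@tidx n).
Local Notation lambda := (@lebesgue_measure R).
Local Notation Rpos := (`]0%R, +oo[%classic : set R).
Local Notation coord_cst := (coord_const L).
Hypothesis L0 : forall i, L i != 0.

Lemma sum_index (F : 'I_(n + n + 1) -> R) :
  \sum_k F k = \sum_(i < n) F (xi i) + \sum_(i < n) F (yi i) + F ti.
Proof. by rewrite big_split_ord/= big_split_ord/= big_ord1. Qed.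

Lemma compact_bound (g : G -> R) (K : set G) : continuous g -> compact K ->
  exists2 B, 0 < B & forall x, K x -> `|g x| <= B.
Proof.
move=> cg cK.
have /compact_bounded[M [_ MB]] : compact (g @` K).
  by apply: continuous_compact => //; exact: continuous_subspaceT.
exists (Num.max 1 (M + 1)); first by rewrite lt_max ltr01.
by move=> x Kx; apply: MB; [rewrite lt_max ltrDl ltr01 orbT|exists x].
Qed.

Lemma compact_rho_bound (K : set G) : compact K ->
  exists2 M, 0 < M & forall x, K x -> rho L x <= M.
Proof.
move=> cK; have [B B0 KB] := compact_bound (@gauge4_continuous _ _ L) cK.
exists (1 + B); first by rewrite addr_gt0.
move=> x Kx; have := KB x Kx; rewrite ger0_norm ?gauge4_ge0// -rho4 => rB.
have [r1|r1] := leP (rho L x) 1; first by rewrite (le_trans r1)// lerDl ltW.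
rewrite (@le_trans _ _ B)//; last by rewrite lerDr.
by apply: le_trans rB; rewrite exprS ler_peMr ?rho_ge0// exprn_ege1// ltW.
Qed.

Section phi.
Variable phi : G -> R.
Hypothesis tphi : test_function phi.

Lemma test_derivable k x : derivable phi x (delta_mx ord0 k).
Proof. by have [/(_ x I [::])[_ /(_ k)]] := tphi. Qed.

Lemma test_partial_continuous k : continuous (partial k phi).
Proof. by move=> x; have [/(_ x I [:: k])[+ _] _] := tphi. Qed.

Lemma test_measurable_partial k : measurable_fun [set: G] (partial k phi).
Proof. by apply: continuous_measurable_rV; exact: test_partial_continuous. Qed.

(** Off its support a test function vanishes in a neighbourhood, and so do its
    partial derivatives; on the support everything is bounded by compactness. *)
Lemma test_bounds : exists M B : R, [/\ 0 < M, 0 < B,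
  forall x, M < rho L x -> phi x = 0 /\ forall k, partial k phi x = 0 &
  forall x k, `|partial k phi x| <= B].
Proof.
have [_ cK] := tphi; set K := closure _ in cK.
have [M M0 KM] := compact_rho_bound cK.
have out x : ~ K x -> phi x = 0 /\ forall k, partial k phi x = 0.
  move=> Kx; have phi0 : \forall y \near x, phi y = 0.
    have : nbhs x (~` K).
      by apply: open_nbhs_nbhs; split=> //; exact/closed_openC/closed_closure.
    apply: filterS => y Ky; apply/eqP; apply/negPn/negP => y0.
    by apply: Ky; exact: subset_closure.
  split; first exact: nbhs_singleton phi0.
  move=> k; rewrite (near_partial k phi0).
  exact: derive_cst.
have [B B0 KB] : exists2 B, 0 < B & forall k x, K x -> `|partial k phi x| <= B.
  have /choice[b hb] k : exists B, 0 < B /\ forall x, K x -> `|partial k phi x| <= B.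
    by have [B ? ?] := compact_bound (@test_partial_continuous k) cK; exists B.
  exists (1 + \sum_k b k).
    by rewrite ltr_pwDl// sumr_ge0// => k _; exact/ltW/(hb k).1.
  move=> k x Kx; apply: le_trans ((hb k).2 x Kx) _.
  rewrite (bigD1 k)//= addrCA lerDl addr_ge0// sumr_ge0// => l _.
  exact/ltW/(hb l).1.
exists M, B; split => //.
  by move=> x Mx; apply: out => /KM; rewrite leNgt Mx.
move=> x k; have [Kx|Kx] := pselect (K x); first exact: KB.
by have [_ ->] := out x Kx; rewrite normr0 ltW.
Qed.

(** The factor rho comes from the coefficients of [euler], which vanish at the
    origin; it compensates for the singular weight rho^(-Q). *)
Lemma euler_bound : exists M C : R, [/\ 0 < M, 0 <= C,
  forall x, M < rho L x -> phi x = 0 &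
  forall x, `|euler phi x| <= C * (rho L x * (rho L x <= M)%R%:R)].
Proof.
have [M [B [M0 B0 out bd]]] := test_bounds.
have K1 := coord_cst_ge1 L; have K0 := le_trans ler01 K1.
exists M, (\sum_(i < n) (coord_cst * B + coord_cst * B) + M * B); split => //.
- apply: addr_ge0; last by rewrite mulr_ge0 ?ltW.
  by apply: sumr_ge0 => i _; rewrite addr_ge0// mulr_ge0// ltW.
- by move=> x /out[].
move=> x; have [xM|xM] := leP (rho L x) M; last first.
  have [_ p0] := out x xM.
  rewrite /euler !p0 big1 => [|i _]; last by rewrite !p0 !mulr0 addr0.
  by rewrite !mulr0 addr0 normr0.
rewrite mulr1 mulrDl mulr_suml /euler.
apply: le_trans (ler_normD _ _) _; rewrite lerD//.
  apply: le_trans (ler_norm_sum _ _ _) _; apply: ler_sum => i _.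
  apply: le_trans (ler_normD _ _) _; rewrite mulrDl lerD// normrM.
    rewrite mulrAC ler_pM//; apply: le_trans (coord_le_sqrt_x L0 i x) _.
    by rewrite ler_wpM2l// sqrt_horiz_sq_le_rho.
  rewrite mulrAC ler_pM//; apply: le_trans (coord_le_sqrt_y L0 i x) _.
  by rewrite ler_wpM2l// sqrt_horiz_sq_le_rho.
rewrite normrM mulrAC ler_pM// normrM ger0_norm//.
have h1 := t_le_rho L x.
have h2 : rho L x ^+ 2 <= M * rho L x by rewrite expr2 ler_wpM2r// rho_ge0.
have := normr_ge0 (x ord0 ti); lra.
Qed.

Lemma is_derive_dil (x : G) (s : R) k :
  is_derive s 1 (fun s => dil s x ord0 k : R^o)
    (if k == ti then 2 * s * x ord0 ti else x ord0 k).
Proof.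
have -> : (fun s => dil s x ord0 k) = (fun s => dil_weight s k * x ord0 k).
  by apply/funext => r; rewrite mxE.
rewrite /dil_weight; have [->|kt] := eqVneq k ti.
  apply: (@is_derive_eq _ _ _ ((id : R -> R) ^+ 2 * cst (x ord0 ti))).
  rewrite scaler0 add0r expr1 /GRing.scale /=; ring.
apply: (@is_derive_eq _ _ _ ((id : R -> R) * cst (x ord0 k))).
by rewrite scaler0 add0r /GRing.scale /= mulr1.
Qed.

Lemma is_derive_orbit (x : G) (s : R) :
  is_derive s 1 (fun s => phi (dil s x))
    (\sum_k (if k == ti then 2 * s * x ord0 ti else x ord0 k) * partial k phi (dil s x)).
Proof.
apply: (@is_derive_curve _ _ phi (fun s => dil s x)).
- by move=> k y; exact: test_derivable.
- exact: test_partial_continuous.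
- by move=> k; exact: is_derive_dil.
Qed.

Lemma dil_continuous (x : G) : continuous (fun s => dil s x).
Proof.
move=> s; apply/differentiable_continuous/derivable1_diffP.
by apply/derivable_mxP => i j; rewrite (ord1 i); have [] := is_derive_dil x s j.
Qed.

(** The derivative along a dilation orbit is [euler] divided by s. *)
Lemma orbit_derivative (x : G) (s : R) : 0 < s ->
  (\sum_k (if k == ti then 2 * s * x ord0 ti else x ord0 k) * partial k phi (dil s x))
  = euler phi (dil s x) * s `^ (- 1).
Proof.
move=> s0; rewrite sum_index eqxx powR_inv1 ?ltW// /euler dil_ti.
under [in RHS]eq_bigr do rewrite dil_xi dil_yi -!mulrA -mulrDr.
rewrite -mulr_sumr big_split/=.
under eq_bigr do rewrite xi_ti.
under [X in _ + X + _]eq_bigr do rewrite yi_ti.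
by field; rewrite gt_eqF.
Qed.

(** The fundamental theorem of calculus along a dilation orbit, which joins the
    origin to a point outside the support. *)
Lemma radial_integral (x : G) : x != 0 ->
  (\int[lambda]_(s in Rpos) (euler phi (dil s x) * s `^ (- 1))%:E = (- phi 0)%:E)%E.
Proof.
move=> x0; have [M [C [M0 C0 out bd]]] := euler_bound.
have r0 := rho_gt0 L0 x0.
(* The orbit of x is outside the support of phi for s >= S. *)
pose S := (M + 1) / rho L x.
have S0 : 0 < S by rewrite divr_gt0// addr_gt0.
have rS s : S <= s -> M < rho L (dil s x).
  move=> Ss; rewrite rho_dil; last exact: ltW (lt_le_trans S0 Ss).
  by rewrite (@lt_le_trans _ _ (M + 1)) ?ltrDl// -ler_pdivrMr.
pose D s := \sum_k (if k == ti then 2 * s * x ord0 ti else x ord0 k) * partial k phi (dil s x).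
have cD : continuous D.
  apply: (@continuous_big R^o _ +%R 0 xpredT); first exact: add_continuous.
  move=> k _ s.
  have c1 : {for s, continuous (fun s : R => if k == ti then 2 * s * x ord0 ti else x ord0 k : R)}.
    case: (k == ti); last exact: cst_continuous.
    have c2 := continuousM (@cst_continuous _ _ (2 : R) s) (@cvg_id _ _ : {for s, continuous id}).
    exact: (continuousM c2 (@cst_continuous _ _ (x ord0 ti) s)).
  have c3 : {for s, continuous (fun s => partial k phi (dil s x))}.
    apply: (@continuous_comp _ _ _ (fun s => dil s x) (partial k phi)).
      exact: dil_continuous.
    exact: test_partial_continuous.
  exact: (continuousM c1 c3).
have dP (s : R) := is_derive_orbit x s.
have cP : continuous (fun s => phi (dil s x)).
  move=> s; apply/differentiable_continuous/derivable1_diffP.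
  by have [] := dP s.
transitivity (\int[lambda]_(s in `[0%R, S]) (D s)%:E)%E.
  rewrite -integral_itv_obnd_cbnd; last first.
    apply/measurable_EFinP; apply: measurable_funTS.
    exact: continuous_measurable_fun.
  rewrite integral_mkcond [RHS]integral_mkcond; apply: eq_integral => s _.
  rewrite !patchE.
  have E1 : (s \in Rpos) = (0 < s) by apply/idP/idP; rewrite in_setE/= in_itv/= andbT.
  have E2 : (s \in (`]0%R, S]%classic : set R)) = (0 < s <= S).
    by apply/idP/idP; rewrite in_setE/= in_itv.
  rewrite E1 E2; have [s0|//] := ltP 0 s => /=.
  have [sS|Ss] := leP s S; first by rewrite /D orbit_derivative.
  have out_s : (rho L (dil s x) <= M) = false.
    by apply/negbTE; rewrite -ltNge rS// ltW.
  have := bd (dil s x); rewrite out_s !mulr0 normr_le0 => /eqP ->.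
  by rewrite mul0r.
rewrite (@continuous_FTC2 _ D (fun s => phi (dil s x)))//.
- have [-> _] : phi (dil S x) = 0 /\ True by split=> //; apply/out/rS.
  rewrite -EFinB sub0r (_ : dil 0 x = 0)//.
  apply/rowP => k; rewrite !mxE /dil_weight expr0n/=.
  by case: ifP => _; rewrite mul0r.
- exact: continuous_subspaceT.
- split.
  + by move=> s _; have [] := dP s.
  + by apply: cvg_at_right_filter; exact: cP.
  + by apply: cvg_at_left_filter; exact: cP.
- by move=> s _; rewrite derive1E; have [_ ->] := dP s.
Qed.

End phi.

End test_functions.

(** * Integrals of angular derivatives *)

Section rotation_integral.
Context {R : realType} {m : nat}.
Local Notation mu := (@lebesgue_rV R m).
Local Notation lambda := (@lebesgue_measure R).

Lemma ge0_integral_preserving (h : 'rV[R]_m -> 'rV[R]_m) (g : 'rV[R]_m -> \bar R) :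
  lebesgue_preserving h -> measurable_fun [set: 'rV[R]_m] g ->
  (forall x, 0 <= g x)%E -> (\int[mu]_x g (h x) = \int[mu]_x g x)%E.
Proof.
move=> [mh hE] mg g0.
rewrite [RHS](@ge0_integral_rV_transfer R m h (NngNum (@ler01 R)))//= ?mul1e//.
by move=> A mA; rewrite mul1e hE.
Qed.

Lemma integral_preserving (h : 'rV[R]_m -> 'rV[R]_m) (g : 'rV[R]_m -> \bar R) :
  lebesgue_preserving h -> measurable_fun [set: 'rV[R]_m] g ->
  (\int[mu]_x g (h x) = \int[mu]_x g x)%E.
Proof.
move=> hh mg; rewrite integralE [RHS]integralE.
rewrite -(ge0_integral_preserving hh (measurable_funepos mg)); last first.
  by move=> x; exact: funepos_ge0.
rewrite -(ge0_integral_preserving hh (measurable_funeneg mg)); last first.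
  by move=> x; exact: funeneg_ge0.
by congr (_ - _)%E; apply: eq_integral => x _; rewrite ?funeposE ?funenegE.
Qed.

(** The derivative of f under the rotation of the plane of the coordinates i and
    k. *)
Definition rotation_field (i k : 'I_m) (f : 'rV[R]_m -> R) (x : 'rV[R]_m) : R :=
  x ord0 i * partial k f x - x ord0 k * partial i f x.

Variables (i k : 'I_m) (f A : 'rV[R]_m -> R).
Hypothesis ik : i != k.
Hypothesis df : forall l y, derivable f y (delta_mx ord0 l).
Hypothesis cf : forall l, continuous (partial l f).
Hypothesis mA : measurable_fun [set: 'rV[R]_m] A.
Hypothesis rotA : forall c s x, c ^+ 2 + s ^+ 2 = 1 -> A (rot i k c s x) = A x.

Let r (t : R) (x : 'rV[R]_m) := rot i k (cos t) (sin t) x.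

Let rE_i t x : r t x ord0 i = cos t * x ord0 i - sin t * x ord0 k.
Proof. by rewrite mxE eqxx. Qed.

Let rE_k t x : r t x ord0 k = sin t * x ord0 i + cos t * x ord0 k.
Proof. by rewrite mxE eq_sym (negbTE ik) eqxx. Qed.

Let is_derive_r_coord (t : R) x l : is_derive t 1 (fun t => r t x ord0 l : R^o)
  (if l == i then - r t x ord0 k else if l == k then r t x ord0 i else 0).
Proof.
rewrite rE_i rE_k; have [->|li] := eqVneq l i.
  rewrite (_ : (fun _ => _) =
    (cos : R -> R) * cst (x ord0 i) - (sin : R -> R) * cst (x ord0 k)); last first.
    by apply/funext => u; rewrite rE_i.
  apply: is_derive_eq; rewrite !scaler0 !add0r /GRing.scale /=; ring.
have [->|lk] := eqVneq l k.
  rewrite (_ : (fun _ => _) =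
    (sin : R -> R) * cst (x ord0 i) + (cos : R -> R) * cst (x ord0 k)); last first.
    by apply/funext => u; rewrite rE_k.
  apply: is_derive_eq; rewrite !scaler0 !add0r /GRing.scale /=; ring.
rewrite (_ : (fun _ => _) = cst (x ord0 l)); first exact: is_derive_cst.
by apply/funext => u; rewrite mxE (negbTE li) (negbTE lk).
Qed.

Let is_derive_r (t : R) x :
  is_derive t 1 (fun t => f (r t x)) (rotation_field i k f (r t x)).
Proof.
have h := is_derive_curve df cf (is_derive_r_coord t x).
apply: is_derive_eq h _; rewrite (bigD1 i)//= eqxx (bigD1 k)/=; last by rewrite eq_sym.
rewrite eq_sym (negbTE ik) eqxx big1 ?addr0 => [|l /andP[li lk]].
  by rewrite /rotation_field; ring.
by rewrite (negbTE li) (negbTE lk) mul0r.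
Qed.

Let continuous_r x : continuous (fun t => r t x).
Proof.
move=> t; apply/differentiable_continuous/derivable1_diffP.
by apply/derivable_mxP => a j; rewrite (ord1 a); have [] := is_derive_r_coord t x j.
Qed.

Let continuous_field : continuous (rotation_field i k f).
Proof.
move=> x.
have ck : {for x, continuous (partial k f)} by exact: cf.
have ci : {for x, continuous (partial i f)} by exact: cf.
exact: (continuousB (continuousM (@coord_continuous R 1 m ord0 i x) ck)
                    (continuousM (@coord_continuous R 1 m ord0 k x) ci)).
Qed.

Let turn x : (\int[lambda]_(t in `[0%R, (2 * pi)%R]) (rotation_field i k f (r t x))%:E = 0)%E.
Proof.
have cP : continuous (fun t => f (r t x)).
  move=> t; apply/differentiable_continuous/derivable1_diffP.
  by have [] := is_derive_r t x.
rewrite (@continuous_FTC2 _ _ (fun t => f (r t x))).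
- rewrite -EFinB (_ : r (2 * pi) x = r 0 x) ?subrr//.
  by rewrite /r mulr_natl cos2pi sin2pi cos0 sin0.
- by rewrite mulr_gt0// pi_gt0.
- apply: continuous_subspaceT => t.
  apply: (@continuous_comp _ _ _ (fun t => r t x) (rotation_field i k f)).
    exact: continuous_r.
  exact: continuous_field.
- split.
  + by move=> t _; have [] := is_derive_r t x.
  + by apply: cvg_at_right_filter; exact: cP.
  + by apply: cvg_at_left_filter; exact: cP.
- by move=> t _; rewrite derive1E; have [_ ->] := is_derive_r t x.
Qed.

Local Notation turn_itv := (`[0%R, (2 * pi)%R]%classic : set R).

Let measurable_r :
  measurable_fun [set: 'rV[R]_m * measurableTypeR R] (fun z => r z.2 z.1).
Proof.
have mcos := measurableT_comp (continuous_measurable_fun (@continuous_cos R))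
  (@measurable_snd _ _ 'rV[R]_m (measurableTypeR R)).
have msin := measurableT_comp (continuous_measurable_fun (@continuous_sin R))
  (@measurable_snd _ _ 'rV[R]_m (measurableTypeR R)).
have mc l := measurableT_comp (@measurable_coord R m l)
  (@measurable_fst _ _ 'rV[R]_m (measurableTypeR R)).
apply: measurable_fun_coordP => l; under eq_fun do rewrite mxE.
case: (l == i).
  exact: (measurable_funB (measurable_funM mcos (mc i)) (measurable_funM msin (mc k))).
case: (l == k); last exact: mc.
exact: (measurable_funD (measurable_funM msin (mc i)) (measurable_funM mcos (mc k))).
Qed.

(** For each t, the rotation r t preserves the integral of g; Fubini's theorem
    exchanges the integral with the average over t. *)
Let average_r (g : 'rV[R]_m -> R) : measurable_fun [set: 'rV[R]_m] g ->
  mu.-integrable [set: 'rV[R]_m] (EFin \o g) ->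
  (\int[mu]_x \int[lambda]_(t in turn_itv) (g (r t x))%:E =
   (2 * pi)%:E * \int[mu]_x (g x)%:E)%E.
Proof.
move=> mg intg.
have prer t : lebesgue_preserving (r t).
  by apply: lebesgue_preserving_rot => //; exact: cos2Dsin2.
pose F (z : 'rV[R]_m * measurableTypeR R) := (\1_turn_itv z.2 * g (r z.2 z.1))%:E.
have ind0 (t : R) : 0 <= \1_turn_itv t :> R by rewrite indicE.
have mind : measurable_fun setT (\1_turn_itv : measurableTypeR R -> R).
  by apply: measurable_indic; exact: measurable_itv.
have mF : measurable_fun [set: 'rV[R]_m * measurableTypeR R] F.
  apply/measurable_EFinP; apply: measurable_funM.
    exact: (measurableT_comp mind measurable_snd).
  exact: (measurableT_comp mg measurable_r).
have mabs : measurable_fun [set: 'rV[R]_m] (fun x => `|(g x)%:E|%E).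
  by apply/measurable_EFinP; exact: measurableT_comp.
have mgr t : measurable_fun [set: 'rV[R]_m] (fun x => g (r t x)).
  exact: (measurableT_comp mg (prer t).1).
have mabsr t : measurable_fun [set: 'rV[R]_m] (fun x => `|(g (r t x))%:E|%E).
  by apply/measurable_EFinP; exact: (measurableT_comp _ (mgr t)).
have absE t : (\int[mu]_x `|(g (r t x))%:E| = \int[mu]_x `|(g x)%:E|)%E.
  exact: (ge0_integral_preserving (prer t) mabs (fun x => abse_ge0 _)).
have gE t : (\int[mu]_x (g (r t x))%:E = \int[mu]_x (g x)%:E)%E.
  by apply: (integral_preserving (prer t) (g := EFin \o g)); exact/measurable_EFinP.
have I0 : (\int[mu]_x `|(g x)%:E| < +oo)%E by have /integrableP[] := intg.
have lT : lambda turn_itv = (2 * pi)%:E.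
  by rewrite lebesgue_measure_itv/= lte_fin mulr_gt0 ?pi_gt0// sube0.
have indT : (\int[lambda]_t (\1_turn_itv t)%:E = (2 * pi)%:E)%E.
  rewrite integral_indic; [|by []|exact: measurable_itv].
  by rewrite setIT; exact: lT.
have intF : (mu \x lambda)%E.-integrable setT F.
  apply: (proj2 (@integrable21ltyP _ _ _ _ _ mu lambda F mF)).
  have E t : (\int[mu]_x `|F (x, t)| = (\1_turn_itv t)%:E * \int[mu]_x `|(g x)%:E|)%E.
    rewrite -(absE t) -ge0_integralZl.
    - apply: eq_integral => x _; rewrite /F [(x, t).1]/= [(x, t).2]/=.
      by rewrite EFinM abseM; congr (_ * _)%E; rewrite gee0_abs// lee_fin.
    - by [].
    - exact: mabsr.
    - by move=> x _; exact: abse_ge0.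
    - by rewrite lee_fin.
  under eq_integral do rewrite E.
  have fI : (\int[mu]_x `|(g x)%:E|)%E \is a fin_num.
    by rewrite ge0_fin_numE//; exact: integral_ge0.
  rewrite -(fineK fI) ge0_integralZr.
  - by rewrite indT -EFinM ltry.
  - by [].
  - exact/measurable_EFinP.
  - by move=> t _; rewrite lee_fin.
  - by rewrite lee_fin fine_ge0// integral_ge0.
transitivity (\int[mu]_x \int[lambda]_t F (x, t))%E.
  apply: eq_integral => x _; rewrite integral_mkcond; apply: eq_integral => t _.
  rewrite patchE /F [(x, t).1]/= [(x, t).2]/= indicE.
  by case: ifP => _; rewrite ?mul1r ?mul0r.
rewrite (Fubini intF) -indT.
have fI : (\int[mu]_x (g x)%:E)%E \is a fin_num by exact: integrable_fin_num.
transitivity (\int[lambda]_t ((\1_turn_itv t)%:E * \int[mu]_x (g x)%:E))%E.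
  apply: eq_integral => t _; rewrite -(gE t) -integralZl.
  - by apply: eq_integral => x _; rewrite /F [(x, t).1]/= [(x, t).2]/= EFinM.
  - by [].
  - by apply/integrableP; split; [exact/measurable_EFinP|rewrite absE].
rewrite -(fineK fI) muleC; under eq_integral do rewrite muleC.
rewrite integralZl//; apply/integrableP; split; first exact/measurable_EFinP.
under eq_integral do rewrite gee0_abs ?lee_fin//.
by rewrite indT ltry.
Qed.

(** Averaging over all rotations does not change the integral. As A is invariant,
    the average of the integrand at x is A x times the integral over a full turn
    of the derivative of f (r t x) with respect to t, which vanishes. *)
Lemma integral_rotation_eq0 :
  mu.-integrable [set: 'rV[R]_m] (fun x => (A x * rotation_field i k f x)%:E) ->
  (\int[mu]_x (A x * rotation_field i k f x)%:E = 0)%E.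
Proof.
move=> intg.
have mg : measurable_fun [set: 'rV[R]_m] (fun x => A x * rotation_field i k f x).
  by apply: measurable_funM => //; exact: continuous_measurable_rV.
have := average_r mg intg.
rewrite [LHS]integral0_eq; last first.
  move=> x _.
  transitivity (\int[lambda]_(t in turn_itv) ((A x)%:E * (rotation_field i k f (r t x))%:E))%E.
    by apply: eq_integral => t _; rewrite /r rotA ?cos2Dsin2.
  rewrite integralZl; first by rewrite turn mule0.
  - exact: measurable_itv.
  apply: continuous_compact_integrable; first exact: segment_compact.
  apply: continuous_subspaceT => t.
  apply: (@continuous_comp _ _ _ (fun t => r t x) (rotation_field i k f)).
    exact: continuous_r.
  exact: continuous_field.
move=> /esym/eqP; rewrite mule_eq0 => /orP[|/eqP //].
by rewrite eqe gt_eqF// mulr_gt0// pi_gt0.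
Qed.

End rotation_integral.

(** * The constant omega *)

Section fundamental_solution.
Context {R : realType} {n : nat} (L : 'I_n -> R).
Local Notation G := 'rV[R]_(n + n + 1).
Local Notation ti := (@tidx n).
Local Notation dd := (horiz_sq L).
Local Notation NN := (gauge4 L).
Local Notation mu := (@lebesgue_rV R (n + n + 1)).
Local Notation pball := (punctured_ball L).
Hypothesis L0 : forall i, L i != 0.

Lemma mu_origin : mu [set (0 : G)] = 0%E.
Proof.
have -> : [set (0 : G)] = box (fun=> [set (0 : R)]).
  apply/seteqP; split => x /=; first by move=> -> k; rewrite mxE.
  by move=> x0; apply/rowP => k; rewrite x0 mxE.
have mA (k : 'I_(n + n + 1)) : measurable [set (0 : R)] by exact: measurable_set1.
rewrite (lebesgue_rV_box mA).
by rewrite (bigD1 ti)//= lebesgue_measure_set1 mul0e.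
Qed.

Lemma measurable_origin : measurable [set (0 : G)].
Proof.
by apply: closed_measurable_rV;
  exact: compact_closed (@norm_hausdorff _ _) (@compact_set1 _ _).
Qed.

(** The derivatives of functions smooth off the origin are meaningless at the
    origin; the next lemmas replace integrands by explicit formulas valid
    elsewhere. *)
Lemma measurable_off0 (f g : G -> R) : (forall x, x != 0 -> f x = g x) ->
  measurable_fun [set: G] g -> measurable_fun [set: G] f.
Proof.
move=> fg mg.
have -> : f = (fun x => g x + (f 0 - g 0) * \1_[set (0 : G)] x).
  apply/funext => x; rewrite indicE; have [->|x0] := eqVneq x 0.
    by rewrite mem_set// mulr1 subrKC.
  by rewrite memNset ?mulr0 ?addr0 ?fg//; exact/eqP.
apply: measurable_funD => //; apply: measurable_funM => //.
by apply: measurable_indic; exact: measurable_origin.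
Qed.

Lemma ae_eq_off0 (D : set G) (f g : G -> R) : (forall x, x != 0 -> f x = g x) ->
  ae_eq mu D (EFin \o f) (EFin \o g).
Proof.
move=> fg; exists [set 0]; split; [exact: measurable_origin|exact: mu_origin|].
move=> x /= H; apply: contrapT => x0; apply: H => _.
by rewrite fg//; exact/eqP.
Qed.

Lemma integral_off0 (D : set G) (f g : G -> R) : measurable D ->
  (forall x, x != 0 -> f x = g x) -> measurable_fun [set: G] g ->
  (\int[mu]_(x in D) (f x)%:E = \int[mu]_(x in D) (g x)%:E)%E.
Proof.
move=> mD fg mg; apply: ae_eq_integral => //.
- by apply/measurable_EFinP; apply: measurable_funTS; exact: measurable_off0 mg.
- by apply/measurable_EFinP; apply: measurable_funTS.
- exact: ae_eq_off0.
Qed.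

Lemma integrable_off0 (D : set G) (f g : G -> R) : measurable D ->
  (forall x, x != 0 -> f x = g x) -> measurable_fun [set: G] g ->
  mu.-integrable D (EFin \o g) -> mu.-integrable D (EFin \o f).
Proof.
move=> mD fg mg /integrableP[_ ig]; apply/integrableP; split.
  by apply/measurable_EFinP; apply: measurable_funTS; exact: measurable_off0 mg.
rewrite (@integral_off0 D (fun x => `|f x|) (fun x => `|g x|))//.
- by move=> x x0; rewrite fg.
- exact: measurableT_comp.
Qed.

(** Off the origin this is the power q of the length of the horizontal gradient of
    the gauge; as an explicit formula it is measurable everywhere. *)
Definition hgrad_weight (q : R) (x : G) : R := dd x `^ (q / 2) * rho L x `^ (- q).

Lemma measurable_wt q : measurable_fun [set: G] (hgrad_weight q).
Proof.
apply: measurable_funM; last exact: measurable_rho_pow.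
exact: (measurableT_comp (@measurable_powR R _) (measurable_horiz_sq L)).
Qed.

Lemma wt_ge0 q x : 0 <= hgrad_weight q x.
Proof. by rewrite mulr_ge0 ?powR_ge0. Qed.

Lemma wtE q x : hgrad_weight q x = (Num.sqrt (dd x) / rho L x) `^ q.
Proof.
rewrite /hgrad_weight powRM ?sqrtr_ge0 ?invr_ge0 ?rho_ge0// -powR12_sqrt ?horiz_sq_ge0// -powRrM.
by rewrite -(powR_inv1 (rho_ge0 L x)) -powRrM mulN1r [q / 2]mulrC.
Qed.

Lemma wt_le1 q x : 0 <= q -> hgrad_weight q x <= 1.
Proof.
move=> q0; rewrite wtE.
have b1 : Num.sqrt (dd x) / rho L x <= 1.
  have := rho_ge0 L x; rewrite le_eqVlt => /orP[/eqP <-|r0].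
    by rewrite invr0 mulr0.
  by rewrite ler_pdivrMr// mul1r sqrt_horiz_sq_le_rho.
apply: (@le_trans _ _ (1 `^ q)); last by rewrite powR1.
by apply: ge0_ler_powR; rewrite ?nnegrE// divr_ge0 ?sqrtr_ge0 ?rho_ge0.
Qed.

Lemma wt_dil q s x : 0 < s -> hgrad_weight q (dil s x) = hgrad_weight q x.
Proof.
move=> s0; rewrite !wtE horiz_sq_dil rho_dil ?ltW// sqrtrM ?sqr_ge0// sqrtr_sqr.
by rewrite gtr0_norm// -mulf_div divff ?mul1r// gt_eqF.
Qed.

Lemma wtD q q' x : 0 < dd x -> hgrad_weight (q + q') x = hgrad_weight q x * hgrad_weight q' x.
Proof.
move=> d0; have r0 : 0 < rho L x.
  rewrite lt_neqAle rho_ge0 andbT; apply/eqP => r0.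
  by have := horiz_sq_le_rho L x; rewrite -r0 expr0n/= leNgt d0.
rewrite !wtE powRD//; apply/implyP => _.
by rewrite gt_eqF// divr_gt0// sqrtr_gt0.
Qed.

Lemma hgrad_rho x : x != 0 -> hgrad_norm L (rho L) x = Num.sqrt (dd x) / rho L x.
Proof.
move=> x0; rewrite /hgrad_norm; under eq_bigr do rewrite expr2.
rewrite -[X in Num.sqrt X]/(hpair L (rho L) (rho L) x) hgrad_rho2//.
by rewrite sqrtrM ?horiz_sq_ge0// sqrtrV ?sqr_ge0// sqrtr_sqr ger0_norm ?rho_ge0.
Qed.

Lemma hgrad_rho_pow q x : x != 0 -> hgrad_norm L (rho L) x `^ q = hgrad_weight q x.
Proof. by move=> x0; rewrite hgrad_rho// wtE. Qed.

Section exponent.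
Variable p : R.
Hypothesis p1 : 1 < p.

Let p0 : 0 < p. Proof. exact: lt_trans p1. Qed.
Let p10 : 0 < p - 1. Proof. by rewrite subr_gt0. Qed.

Lemma integrable_wt : mu.-integrable pball (EFin \o hgrad_weight p).
Proof.
apply: measurable_bounded_integrable.
- exact: measurable_pball.
- exact: mu_pball_lty.
- by apply: measurable_funTS; exact: measurable_wt.
exists 1; split=> // M M1 x _ /=; rewrite ger0_norm ?wt_ge0//.
by rewrite (le_trans (wt_le1 _ _) (ltW M1))// ltW.
Qed.

Lemma omegaE : (\int[mu]_(x in pball) (hgrad_weight p x)%:E = (omega L p)%:E)%E.
Proof.
have mB : measurable [set x : G | rho L x < 1].
  rewrite -[X in measurable X]setTI.
  have -> : [set x : G | rho L x < 1] = rho L @^-1` `]-oo, 1[%classic.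
    by apply/seteqP; split => x /=; rewrite in_itv.
  exact: measurable_rho.
rewrite /omega /Rintegral (@integral_off0 _ _ (hgrad_weight p))//; last 2 first.
- by move=> x x0; rewrite hgrad_rho_pow.
- exact: measurable_wt.
have -> : (\int[mu]_(x in [set x : G | (rho L x < 1)%R]) (hgrad_weight p x)%:E =
    \int[mu]_(x in pball) (hgrad_weight p x)%:E)%E.
  rewrite integral_mkcond [RHS]integral_mkcond; apply: eq_integral => x _.
  rewrite !patchE.
  have -> : (x \in [set x : G | rho L x < 1]) = (rho L x < 1).
    by apply/idP/idP; rewrite in_setE.
  have -> : (x \in pball) = (0 < rho L x < 1).
    by apply/idP/idP; rewrite in_setE.
  have := rho_ge0 L x; rewrite le_eqVlt => /orP[/eqP r0|->//].
  by rewrite /hgrad_weight -r0 ltxx ltr01 (@powR0 _ (- p)) ?mulr0// oppr_eq0 gt_eqF.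
by rewrite fineK//; apply: integrable_fin_num integrable_wt; exact: measurable_pball.
Qed.

Hypothesis n0 : (0 < n)%N.

(** Otherwise the weight would vanish almost everywhere on the unit ball. But it is
    positive on a small cube in the open positive orthant, because n > 0. *)
Lemma omega_gt0 : 0 < omega L p.
Proof.
have om0 : 0 <= omega L p.
  rewrite -lee_fin -omegaE; apply: integral_ge0 => x _.
  by rewrite lee_fin wt_ge0.
rewrite lt_neqAle om0 andbT; apply/eqP => om.
have mwt : measurable_fun pball (EFin \o hgrad_weight p).
  by apply/measurable_EFinP; apply: measurable_funTS; exact: measurable_wt.
have : (\int[mu]_(x in pball) `|(EFin \o hgrad_weight p) x| = 0)%E.
  rewrite -[RHS]/((0 : R)%:E) om -omegaE; apply: eq_integral => x _.
  by rewrite gee0_abs// lee_fin wt_ge0.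
move/(proj1 (ae_eq_integral_abs _ (measurable_pball L) mwt)) => [N [mN N0 subN]].
have NN0 : NN 0 = 0 by rewrite -rho4 rho0 expr0n.
have /cvgrPdist_lt/(_ _ ltr01)/nbhs_ballP[r /= r0 rB] := @gauge4_continuous _ _ L 0.
(* On the cube ]r/4, r/2[^(2n+1), rho < 1 by the choice of r, and d > 0. *)
pose A (k : 'I_(n + n + 1)) : set R := `](r / 4), (r / 2)[%classic.
have mA k : measurable (A k) by exact: measurable_itv.
have subA : box A `<=` N.
  move=> x Ax; apply: subN => /= H.
  have xA k : r / 4 < x ord0 k < r / 2 by have := Ax k; rewrite /A /= in_itv.
  have x0 : x ord0 (xi (Ordinal n0)) != 0.
    have /andP[h _] := xA (xi (Ordinal n0)).
    by rewrite gt_eqF// (lt_trans _ h)// divr_gt0.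
  have d0 : 0 < dd x.
    apply: lt_le_trans (horiz_sq_ge_x L (Ordinal n0) x).
    rewrite pmulr_rgt0; first by rewrite exprn_even_gt0.
    by rewrite mulr_gt0// normr_gt0.
  have r1 : 0 < rho L x.
    by apply: rho_gt0 => //; apply: contraNneq x0 => ->; rewrite mxE.
  have : NN x < 1.
    have := rB x; rewrite NN0 sub0r normrN ger0_norm ?gauge4_ge0//; apply.
    rewrite ball_rVE// => k; rewrite mxE sub0r normrN.
    have /andP[h1 h2] := xA k; have r40 : 0 < r / 4 by rewrite divr_gt0.
    rewrite gtr0_norm ?(lt_trans r40)//; lra.
  rewrite -rho4 expr_lt1 ?rho_ge0// => r2.
  have xB : pball x by rewrite /punctured_ball /= r1 r2.
  move: (H xB) => /eqP; rewrite eqe gt_eqF//.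
  by apply: mulr_gt0; exact: powR_gt0.
have : (mu (box A) <= mu N)%E.
  by apply: le_measure => //; apply/mem_set => //; exact: measurable_box mA.
rewrite [X in (_ <= X)%E]N0 (lebesgue_rV_box mA) leNgt => /negP; apply.
rewrite (eq_bigr (fun=> (r / 2 - r / 4)%:E)); last first.
  move=> k _; rewrite /A lebesgue_measure_itv/= lte_fin ifT//; lra.
rewrite prodEFin lte_fin prodr_gt0// => k _; lra.
Qed.

End exponent.
End fundamental_solution.

(** * The fundamental solution *)

Section gamma.
Context {R : realType} {n : nat} (L : 'I_n -> R).
Local Notation G := 'rV[R]_(n + n + 1).
Local Notation ti := (@tidx n).
Local Notation dd := (horiz_sq L).
Local Notation NN := (gauge4 L).
Local Notation mu := (@lebesgue_rV R (n + n + 1)).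
Local Notation lambda := (@lebesgue_measure R).
Local Notation Q := (@homdim R n).
Local Notation Rpos := (`]0%R, +oo[%classic : set R).
Local Notation pball := (punctured_ball L).
Local Notation coord_cst := (coord_const L).
Local Notation wt := (hgrad_weight L).
Hypothesis n0 : (0 < n)%N.
Hypothesis L0 : forall i, L i != 0.
Variable p : R.
Hypothesis p1 : 1 < p.

Let p10 : 0 < p - 1. Proof. by rewrite subr_gt0. Qed.
Let Q0 : 0 < Q. Proof. by apply: lt_le_trans (@Q_ge2 R n). Qed.
Let om0 : 0 < omega L p. Proof. exact: omega_gt0. Qed.

Let kap : R := (Q * omega L p) `^ (- (p - 1)^-1).
Let b : R := (1 - Q) / (p - 1).

Let kap_gt0 : 0 < kap. Proof. by rewrite powR_gt0// mulr_gt0. Qed.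

Let kap_ge0 : 0 <= kap. Proof. exact: powR_ge0. Qed.

Let kap_pow : kap `^ (p - 1) = (Q * omega L p)^-1.
Proof.
rewrite /kap -powRrM mulNr mulVf ?gt_eqF// powR_inv1// ltW// mulr_gt0//.
Qed.

Let c_ge0 : 0 <= (Q * omega L p)^-1.
Proof. by rewrite -kap_pow powR_ge0. Qed.

Lemma Gamma_elem : elem L (Gamma L p).
Proof.
have [pQ|pQ] := eqVneq p Q.
  have -> : Gamma L p = (fun x => (Cp L p * 4^-1) * ln (NN x)).
    apply/funext => x; rewrite /Gamma ifT; last exact/eqP.
    by rewrite rhoE ln_powR mulrA.
  by apply: elem_scale; exact: elem_ln.
have -> : Gamma L p = (fun x => Cp L p * NN x `^ (4^-1 * ((p - Q) / (p - 1)))).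
  by apply/funext => x; rewrite /Gamma (negbTE pQ) rhoE -powRrM.
by apply: elem_scale; exact: elem_pow.
Qed.

(** Both formulas defining Gamma have the same derivative kap rho^b with respect to
    rho, the case p = Q corresponding to b = -1. *)
Lemma vfY_Gamma j x : x != 0 ->
  vfY L j (Gamma L p) x = kap * rho L x `^ b * vfY L j (rho L) x.
Proof.
move=> x0; apply: vfY_linear1 => k; rewrite {1 2}/partial.
have r0 := rho_gt0 L0 x0.
have [rho' _ /(_ x x0) drho] := elem_is_derive L0 k (elem_pow L 4^-1).
have -> : 'D_(delta_mx ord0 k) (rho L) x = rho' x by have [_ <-] := drho.
have [pQ|pQ] := eqVneq p Q.
  have -> : Gamma L p = Cp L p *: (@ln R \o rho L).
    by apply/funext => y; rewrite /Gamma ifT; last exact/eqP.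
  have dl := is_derive_comp1 (is_derive1_ln r0) drho.
  have [_ ->] := is_deriveZ (Cp L p) dl.
  rewrite /Cp ifT; last exact/eqP.
  have -> : b = -1 by rewrite /b -pQ -opprB mulNr divff ?gt_eqF.
  by rewrite -/kap powR_inv1 ?ltW// /GRing.scale /= mulrA.
have -> : Gamma L p = Cp L p *: ((fun r : R => r `^ ((p - Q) / (p - 1))) \o rho L).
  by apply/funext => y; rewrite /Gamma (negbTE pQ).
have dl := is_derive_comp1 (is_derive1_powR ((p - Q) / (p - 1)) r0) drho.
have [_ ->] := is_deriveZ (Cp L p) dl.
have -> : (p - Q) / (p - 1) - 1 = b by rewrite /b; field; rewrite gt_eqF.
rewrite /Cp (negbTE pQ) -/kap /GRing.scale /=; field.
have -> : 2 * n%:R + 2 = Q by rewrite /homdim natrD natrM.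
by rewrite !subr_eq0 pQ (gt_eqF p1).
Qed.

Lemma hgrad_Gamma x : x != 0 ->
  hgrad_norm L (Gamma L p) x = kap * rho L x `^ b * hgrad_norm L (rho L) x.
Proof.
move=> x0; rewrite /hgrad_norm.
under eq_bigr do rewrite vfY_Gamma// exprMn.
rewrite -mulr_sumr sqrtrM ?sqr_ge0// sqrtr_sqr ger0_norm//.
exact: mulr_ge0 kap_ge0 (powR_ge0 _ _).
Qed.

(** For q = p - 1 the exponent b q is 1 - Q, and kap^(p - 1) is the inverse of
    Q omega. *)
Lemma hgrad_Gamma_pow q x : x != 0 ->
  hgrad_norm L (Gamma L p) x `^ q = kap `^ q * rho L x `^ (b * q) * wt q x.
Proof.
move=> x0; have kb0 := mulr_ge0 kap_ge0 (powR_ge0 (rho L x) b).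
rewrite (hgrad_Gamma x0) (powRM _ kb0 (sqrtr_ge0 _)) hgrad_rho_pow//.
by rewrite (powRM _ kap_ge0 (powR_ge0 _ _)) -powRrM.
Qed.

Let bp : b * (p - 1) = 1 - Q. Proof. by rewrite /b mulfVK// gt_eqF. Qed.

Lemma Gamma_locally_integrable :
  locally_integrable_rV (fun x => hgrad_norm L (Gamma L p) x `^ (p - 1)).
Proof.
move=> K cK; have [M M0 KM] := compact_rho_bound L cK.
have mK := compact_measurable_rV cK.
pose g x := (Q * omega L p)^-1 * (rho L x `^ (1 - Q) * wt (p - 1) x).
have mg : measurable_fun [set: G] g.
  apply: measurable_funM => //; apply: measurable_funM.
    exact: measurable_rho_pow.
  exact: measurable_wt.
apply: (@integrable_off0 _ _ _ _ g mK _ mg).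
  by move=> x x0; rewrite hgrad_Gamma_pow// kap_pow bp /g -[LHS]mulrA.
have ig : mu.-integrable [set: G] (EFin \o (fun x => g x * (rho L x <= M)%R%:R)).
  apply: (integrable_le_ker L0 M0 (C := (Q * omega L p)^-1)).
    by apply: measurable_funM => //; exact: measurable_le_rho.
  move=> x; rewrite /g /radial_kernel.
  have := wt_le1 L x (ltW p10); have := wt_ge0 L (p - 1) x.
  have := powR_ge0 (rho L x) (1 - Q); have := c_ge0.
  move: (_^-1) (_ `^ _) (wt _ x) (_%R%:R : R) (ler0n R (rho L x <= M)%R) => c r w d d0 c0 r0 w0 w1.
  rewrite ger0_norm ?mulr_ge0// -!mulrA; do 2 rewrite ler_wpM2l//.
  exact: ler_piMl.
have := integrableS measurableT mK (@subsetT _ K) ig.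
apply: eq_integrable => // x /set_mem Kx.
by rewrite /= KM// mulr1.
Qed.

Section weak.
Variable phi : G -> R.
Hypothesis tphi : test_function phi.

Let T1 (x : G) : R := (Q * omega L p)^-1 * (wt p x * euler phi x * rho L x `^ (- Q)).

Let A (i : 'I_n) (x : G) : R := (Q * omega L p)^-1 * (L i / `|L i|) * (4 * x ord0 ti) *
  (wt (p - 2) x * rho L x `^ (- Q - 2)).

Let T2 (i : 'I_n) (x : G) : R := A i x * rotation_field (xi i) (yi i) phi x.

(** The identity [hpair_rho] for f = phi splits the integrand into a radial term T1
    and one angular term T2 i for each plane (x_i, x_{i+n}). *)
Lemma weak_integrand (x : G) : x != 0 ->
  hgrad_norm L (Gamma L p) x `^ (p - 2) *
    \sum_j vfY L j (Gamma L p) x * vfY L j phi x = T1 x + \sum_(i < n) T2 i x.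
Proof.
move=> x0; have r0 := rho_gt0 L0 x0.
under eq_bigr do rewrite vfY_Gamma// -mulrA.
rewrite -mulr_sumr -[X in _ * (_ * X)]/(hpair L (rho L) phi x) hpair_rho//.
rewrite hgrad_Gamma_pow// -rho4.
have powD (a u v : R) : 0 < a -> a `^ (u + v) = a `^ u * a `^ v.
  by move=> a0; rewrite powRD//; apply/implyP => _; rewrite gt_eqF.
have kE : kap `^ (p - 2) * kap = (Q * omega L p)^-1.
  rewrite -kap_pow -{2}(powRr1 kap_ge0) -(powD _ _ _ kap_gt0).
  by congr (_ `^ _); ring.
have rE : rho L x `^ (b * (p - 2)) * rho L x `^ b = rho L x `^ (1 - Q).
  by rewrite -(powD _ _ _ r0) -bp; congr (_ `^ _); ring.
have rQ : rho L x `^ (1 - Q) = rho L x * rho L x `^ (- Q).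
  by rewrite (powD _ _ _ r0) powRr1 ?ltW//.
have rQ2 : rho L x `^ (- Q - 2) = rho L x `^ (- Q) / rho L x ^+ 2.
  by rewrite (powD _ _ _ r0) (powRN _ 2) (powR_mulrn 2 (ltW r0)).
have wE : wt (p - 2) x * dd x = wt p x * rho L x ^+ 2.
  have := horiz_sq_ge0 L x; rewrite le_eqVlt => /orP[/eqP d0|d0].
    have p20 : p / 2 != 0 by rewrite gt_eqF// divr_gt0// (lt_trans _ p1).
    by rewrite -d0 mulr0 /hgrad_weight -d0 powR0// !mul0r.
  have -> : wt p x = wt (p - 2) x * wt 2 x by rewrite -wtD// subrK.
  rewrite -mulrA; congr (_ * _).
  by rewrite wtE powR_mulrn ?divr_ge0 ?sqrtr_ge0 ?ltW// expr_div_n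
    sqr_sqrtr ?ltW// divfK// expf_neq0// gt_eqF.
have -> : \sum_(i < n) T2 i x = (Q * omega L p)^-1 * (4 * x ord0 ti) *
  (wt (p - 2) x * rho L x `^ (- Q - 2)) * angular L phi x.
  rewrite /angular mulr_sumr; apply: eq_bigr => i _.
  rewrite /T2 /A /rotation_field; ring.
rewrite /T1 rQ2.
move: kE rE rQ wE r0.
move: (kap `^ (p - 2)) => k1; move: (kap : R) ((Q * omega L p)^-1) => k2 c.
move: (rho L x `^ (b * (p - 2))) (rho L x `^ b) (rho L x `^ (1 - Q))
  (rho L x `^ (- Q)) => r1 r2 r3 r4; move: (rho L x) => r.
move: (wt (p - 2) x) (wt p x) (dd x) (euler phi x) (angular L phi x) (x ord0 ti).
move=> w w' d e th t kE rE rQ wE r0.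
transitivity ((k1 * k2) * (r1 * r2) * (r / r ^+ 4 * ((w * d) * e + 4 * t * w * th))).
  ring.
by rewrite kE rE rQ wE; field; rewrite gt_eqF.
Qed.

Let eq_leR (u v : R) : u = v -> u <= v. Proof. by move=> ->. Qed.

Let rho_powQ x : rho L x * rho L x `^ (- Q) = rho L x `^ (1 - Q).
Proof.
have := rho_ge0 L x; rewrite le_eqVlt => /orP[/eqP <-|r0].
  rewrite mul0r powR0// subr_eq0 lt_eqF// (lt_le_trans _ (@Q_ge2 R n))//.
  by rewrite ltr1n.
by rewrite powRD ?powRr1// ?ltW//; apply/implyP => _; rewrite gt_eqF.
Qed.

Let measurable_euler : measurable_fun [set: G] (euler phi).
Proof.
have mterm k : measurable_fun [set: G] (fun x : G => x ord0 k * partial k phi x).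
  apply: measurable_funM; first exact: measurable_coord.
  exact: test_measurable_partial.
apply: measurable_funD.
  by apply: measurable_sum => i; apply: measurable_funD.
under eq_fun do rewrite -mulrA.
by apply: measurable_funM.
Qed.

Let measurable_T1 : measurable_fun [set: G] T1.
Proof.
apply: measurable_funM => //; apply: measurable_funM; last exact: measurable_rho_pow.
by apply: measurable_funM => //; exact: measurable_wt.
Qed.

Lemma T1_integrable : mu.-integrable [set: G] (EFin \o T1).
Proof.
have [M [C [M0 C0 _ bd]]] := euler_bound L0 tphi.
apply: (integrable_le_ker L0 M0 (C := (Q * omega L p)^-1 * C)) => // x.
rewrite /T1 /radial_kernel -rho_powQ.
have := bd x; have := powR_ge0 (rho L x) (- Q).
have := wt_le1 L x (ltW (lt_trans ltr01 p1)); have := wt_ge0 L p x.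
have := c_ge0; move: ((rho L x <= M)%R%:R : R) => d.
move: (rho L x `^ (- Q)) (wt p x) (euler phi x) => q w e; move: (rho L x) => r.
move: (Q * omega L p)^-1 => c c0 w0 w1 q0 eC.
rewrite !normrM (ger0_norm c0) (ger0_norm w0) (ger0_norm q0).
have h1 : w * `|e| <= C * (r * d) by apply: le_trans eC; rewrite ler_piMl.
have h2 := ler_wpM2l c0 (ler_wpM2r q0 h1).
by apply: le_trans h2 _; apply: eq_leR; ring.
Qed.

Let measurable_orbit (f : G -> R) x : measurable_fun [set: G] f ->
  measurable_fun (Rpos : set (measurableTypeR R)) (fun s => f (dil s x) * s `^ (- 1)).
Proof.
move=> mf; apply: measurable_funTS.
apply: measurable_funM; last exact: measurable_powR.
exact: (measurableT_comp mf (measurableT_comp measurable_dil2 (pair1_measurable x))).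
Qed.

Let orbit_bound : exists C : R, forall x, pball x ->
  (\int[lambda]_(s in Rpos) (`|euler phi (dil s x)| * s `^ (- 1))%:E <= C%:E)%E.
Proof.
have [M [C [M0 C0 _ bd]]] := euler_bound L0 tphi.
exists (C * M) => x /andP[r0 _].
have mr : measurable_fun [set: measurableTypeR R]
    (fun s => (rho L x * (s * rho L x <= M)%R%:R : R)).
  apply: measurable_funM => //.
  have -> : (fun s => (s * rho L x <= M)%R%:R : R) =
      (\1_(`]-oo, M / rho L x]%classic : set R) : R -> R).
    apply/funext => s; rewrite indicE -ler_pdivlMr//; congr (nat_of_bool _)%:R.
    by apply/idP/idP; rewrite in_setE /= in_itv /=.
  by apply: measurable_indic; exact: measurable_itv.
rewrite EFinM -(orbit_integral r0 M0) -ge0_integralZl.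
- apply: ge0_le_integral => //.
  + by move=> s _; rewrite lee_fin mulr_ge0 ?powR_ge0.
  + apply/measurable_EFinP; apply: (measurable_orbit (f := fun y => `|euler phi y|)).
    exact: measurableT_comp.
  + apply/measurable_EFinP; apply: measurable_funM => //; exact: measurable_funTS.
  + move=> s; rewrite /= in_itv /= andbT => s0; rewrite -EFinM lee_fin.
    have := bd (dil s x); rewrite (rho_dil _ _ (ltW s0)) => h.
    have h2 := ler_wpM2r (powR_ge0 s (- 1)) h.
    apply: le_trans h2 _; apply: eq_leR; rewrite (powR_inv1 (ltW s0)).
    by field; rewrite gt_eqF.
- exact: measurable_itv.
- by apply/measurable_EFinP; exact: measurable_funTS.
- by move=> s _; rewrite lee_fin mulr_ge0// ltW.
- by rewrite lee_fin.
Qed.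

(** In polar coordinates the weight is constant along orbits, the orbit integral of
    [euler phi] is - phi 0, and the weight integrates to omega. *)
Lemma T1_integral : (\int[mu]_x (T1 x)%:E = (- phi 0)%:E)%E.
Proof.
have [C bC] := orbit_bound.
pose f x := wt p x * euler phi x.
have mf : measurable_fun [set: G] f by apply: measurable_funM => //; exact: measurable_wt.
have w1 x := wt_le1 L x (ltW (lt_trans ltr01 p1)).
have bf x : pball x ->
    (\int[lambda]_(s in Rpos) (`|f (dil s x)| * s `^ (- 1))%:E <= C%:E)%E.
  move=> xB; apply: le_trans (bC x xB); apply: ge0_le_integral => //.
  - by move=> s _; rewrite lee_fin mulr_ge0 ?powR_ge0.
  - apply/measurable_EFinP; apply: (measurable_orbit (f := fun y => `|f y|)).
    exact: measurableT_comp.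
  - apply/measurable_EFinP; apply: (measurable_orbit (f := fun y => `|euler phi y|)).
    exact: measurableT_comp.
  - move=> s _; rewrite lee_fin ler_wpM2r ?powR_ge0// /f normrM ger0_norm ?wt_ge0//.
    by rewrite ler_piMl.
have P := polar L0 mf bf.
have Qom : Q * omega L p != 0 by rewrite gt_eqF// mulr_gt0.
have inner x : pball x ->
    (\int[lambda]_(s in Rpos) (f (dil s x) * s `^ (- 1))%:E = (- phi 0)%:E * (wt p x)%:E)%E.
  move=> xB; have x0 : x != 0.
    by apply/eqP => x0; move: xB; rewrite x0 /punctured_ball /= rho0 ltxx.
  transitivity (\int[lambda]_(s in Rpos) ((wt p x)%:E * (euler phi (dil s x) * s `^ (- 1))%:E))%E.
    apply: eq_integral => s; rewrite in_setE /= in_itv /= andbT => s0.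
    by rewrite /f wt_dil// -mulrA.
  rewrite integralZl.
  - by rewrite (radial_integral L0)// muleC.
  - by [].
  apply/integrableP; split; first by apply/measurable_EFinP; exact: measurable_orbit.
  apply: le_lt_trans (ltry C); apply: le_trans (bC x xB).
  by under eq_integral do rewrite abse_EFin normrM (ger0_norm (powR_ge0 _ _)).
have PE : (\int[mu]_x (f x * (Q^-1 * rho L x `^ (- Q)))%:E = (- phi 0 * omega L p)%:E)%E.
  rewrite P (eq_integral (fun x => ((- phi 0)%:E * (wt p x)%:E)%E)); last first.
    by move=> x /set_mem xB; exact: inner.
  rewrite integralZl; [|exact: measurable_pball|exact: integrable_wt].
  by rewrite omegaE.
have T1E x : T1 x = (omega L p)^-1 * (f x * (Q^-1 * rho L x `^ (- Q))).
  rewrite /T1 /f invfM; move: (omega L p)^-1 Q^-1 (wt p x) => o q w; ring.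
have fE x : f x * (Q^-1 * rho L x `^ (- Q)) = omega L p * T1 x.
  by rewrite T1E mulVKf// gt_eqF.
under eq_integral do rewrite T1E EFinM.
rewrite integralZl//.
  by rewrite PE -EFinM mulrC mulfK// gt_eqF.
under eq_fun do rewrite fE EFinM.
by apply: integrableZl => //; exact: T1_integrable.
Qed.

Let measurable_A i : measurable_fun [set: G] (A i).
Proof.
apply: measurable_funM.
  apply: measurable_funM => //; apply: measurable_funM => //.
  exact: measurable_coord.
by apply: measurable_funM; [exact: measurable_wt|exact: measurable_rho_pow].
Qed.

Let measurable_field i : measurable_fun [set: G] (rotation_field (xi i) (yi i) phi).
Proof.
by apply: measurable_funB; apply: measurable_funM;
  (exact: measurable_coord || exact: test_measurable_partial).
Qed.

(** The power p - 2 may be negative, and the weight then blows up where d = 0; the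
    factor sqrt(d) contributed by the angular derivative compensates, since
    p - 1 > 0. *)
Lemma T2_integrable i : mu.-integrable [set: G] (EFin \o T2 i).
Proof.
have [M [B [M0 B0 out bd]]] := test_bounds L tphi.
have K0 : 0 <= coord_cst := le_trans ler01 (coord_cst_ge1 L).
pose c := (Q * omega L p)^-1.
apply: (integrable_le_ker L0 M0 (C := c * (2 * coord_cst * B))).
  by apply: measurable_funM; [exact: measurable_A|exact: measurable_field].
move=> x; have [xM|xM] := leP (rho L x) M; last first.
  have [_ p0] := out x xM.
  rewrite /T2 /rotation_field !p0 !mulr0 subrr mulr0 normr0 mulr_ge0 ?ker_ge0//.
  by rewrite mulr_ge0 ?c_ge0// !mulr_ge0// ltW.
rewrite /radial_kernel xM mulr1 -rho_powQ.
(* The vector field has coefficients x_i and x_{i+n}, which are O(sqrt(d)). *)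
have fb : `|rotation_field (xi i) (yi i) phi x| <= 2 * coord_cst * B * Num.sqrt (dd x).
  apply: le_trans (ler_normB _ _) _; rewrite !normrM.
  have h1 := ler_pM (normr_ge0 _) (normr_ge0 _) (coord_le_sqrt_x L0 i x) (bd x (yi i)).
  have h2 := ler_pM (normr_ge0 _) (normr_ge0 _) (coord_le_sqrt_y L0 i x) (bd x (xi i)).
  apply: le_trans (lerD h1 h2) _; apply: eq_leR; ring.
have wb : wt (p - 2) x * Num.sqrt (dd x) <= rho L x.
  have := horiz_sq_ge0 L x; rewrite le_eqVlt => /orP[/eqP <-|d0].
    by rewrite sqrtr0 mulr0 rho_ge0.
  have r0 : 0 < rho L x by apply: lt_le_trans (sqrt_horiz_sq_le_rho L x); rewrite sqrtr_gt0.
  have -> : wt (p - 2) x * Num.sqrt (dd x) = wt (p - 1) x * rho L x.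
    have -> : p - 1 = (p - 2) + 1 by ring.
    rewrite (wtD (p - 2) 1 d0) -mulrA; congr (_ * _).
    rewrite wtE powRr1 ?divr_ge0 ?sqrtr_ge0 ?ltW//.
    by rewrite divfK// gt_eqF.
  apply: ler_piMl (ltW r0) _; apply: wt_le1; exact: ltW.
have tb := t_le_rho L x.
have rE : rho L x ^+ 2 * rho L x `^ (- Q - 2) <= rho L x `^ (- Q).
  have := rho_ge0 L x; rewrite le_eqVlt => /orP[/eqP <-|r0].
    by rewrite expr0n mul0r powR_ge0.
  rewrite powRB; last by apply/implyP => _; rewrite gt_eqF.
  by rewrite (powR_mulrn 2 (ltW r0)) mulrC divfK// expf_neq0// gt_eqF.
have sg : `|L i / `|L i| | = 1.
  by rewrite normrM normfV normr_id divff// normr_eq0.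
rewrite /T2 /A; move: fb wb tb rE sg c_ge0; rewrite -/c.
have := sqrtr_ge0 (dd x); have := wt_ge0 L (p - 2) x; have := rho_ge0 L x.
have := powR_ge0 (rho L x) (- Q - 2).
have : 0 <= 2 * coord_cst * B by rewrite !mulr_ge0// ltW.
move: (c) (2 * coord_cst * B) (L i / `|L i|) => {}c k sg.
move: (rho L x `^ (- Q)) (rho L x `^ (- Q - 2)) => q q2.
move: (rotation_field _ _ _ _) (x _ _) (rho L x) (wt _ x) (Num.sqrt _) => f t r w d.
move=> k0 q20 r0 w0 d0 fb wb tb rE sg1 c0.
rewrite !normrM sg1 mulr1 (ger0_norm c0) (ger0_norm w0) (ger0_norm q20) normr_nat.
move: (normr_ge0 f) (normr_ge0 t) fb tb; move: `|f| `|t| => {}f {}t f0 t0 fb tb.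
rewrite -!mulrA ler_wpM2l//.
apply: (@le_trans _ _ (r ^+ 2 * q2 * (k * (w * d)))).
  have h1 : w * f <= w * (k * d) by rewrite ler_wpM2l.
  have h2 := ler_pM (mulr_ge0 (ler0n R 4) t0) (mulr_ge0 w0 f0) tb h1.
  have h3 := ler_wpM2l q20 h2.
  apply: (@le_trans _ _ (q2 * (4 * t * (w * f)))); first by apply: eq_leR; ring.
  by apply: le_trans h3 _; apply: eq_leR; ring.
have h3 : k * (w * d) <= k * r by rewrite ler_wpM2l.
have h4 := ler_pM (mulr_ge0 (sqr_ge0 r) q20) (mulr_ge0 k0 (mulr_ge0 w0 d0)) rE h3.
by apply: le_trans h4 _; apply: eq_leR; ring.
Qed.

(** The coefficient A i depends only on d and t, which rotations of the plane
    (x_i, x_{i+n}) preserve. *)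
Lemma T2_integral i : (\int[mu]_x (T2 i x)%:E = 0)%E.
Proof.
apply: integral_rotation_eq0; last exact: T2_integrable.
- by rewrite xi_yi.
- by move=> l y; exact: test_derivable.
- exact: test_partial_continuous.
- exact: measurable_A.
move=> c s x cs; set y := rot _ _ _ _ x.
have yk k : k != xi i -> k != yi i -> y ord0 k = x ord0 k.
  by move=> kx ky; rewrite mxE (negbTE kx) (negbTE ky).
have ty : y ord0 ti = x ord0 ti by apply: yk; rewrite eq_sym (xi_ti, yi_ti).
have dy : dd y = dd x.
  rewrite /horiz_sq -!big_split /=; apply: eq_bigr => j _; rewrite -!mulrDr.
  congr (_ * _); have [->|ji] := eqVneq j i.
    rewrite !mxE !eqxx [yi i == _]eq_sym xi_yi.
    transitivity ((c ^+ 2 + s ^+ 2) * (x ord0 (xi i) ^+ 2 + x ord0 (yi i) ^+ 2)).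
      ring.
    by rewrite cs mul1r.
  have xx : xi j != xi i by apply: contraNneq ji => /xi_inj ->.
  have yy : yi j != yi i by apply: contraNneq ji => /yi_inj ->.
  have xy : xi j != yi i by rewrite xi_yi.
  have yx : yi j != xi i by rewrite eq_sym xi_yi.
  by rewrite (yk _ xx xy) (yk _ yx yy).
have ry : rho L y = rho L x by rewrite !rhoE /gauge4 dy ty.
by rewrite /A /hgrad_weight ry dy ty.
Qed.

Lemma weak_equation : (\int[mu]_x (hgrad_norm L (Gamma L p) x `^ (p - 2) *
    \sum_j vfY L j (Gamma L p) x * vfY L j phi x)%:E = (- phi 0)%:E)%E.
Proof.
pose S x := T1 x + \sum_(i < n) T2 i x.
have mT1 : measurable_fun [set: G] T1.
  by apply/measurable_EFinP; have /integrableP[] := T1_integrable.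
have mT2 i : measurable_fun [set: G] (T2 i).
  by apply/measurable_EFinP; have /integrableP[] := T2_integrable i.
have mS : measurable_fun [set: G] S.
  by apply: measurable_funD => //; exact: measurable_sum.
rewrite (@integral_off0 _ _ _ _ S measurableT weak_integrand mS).
transitivity (\int[mu]_x ((EFin \o T1) x + \sum_(i < n) (EFin \o T2 i) x))%E.
  by apply: eq_integral => x _; rewrite /S EFinD sumEFin.
rewrite integralD//; first last.
- by apply: integrable_sum => //= i _; exact: T2_integrable.
- exact: T1_integrable.
rewrite integral_sum//; last by move=> i; exact: T2_integrable.
rewrite big1 ?adde0; first exact: T1_integral.
by move=> i _; exact: T2_integral.
Qed.

End weak.

End gamma.

Theorem theorem5p2 (R : realType) (n : nat) (L : 'I_n -> R) :
  (0 < n)%N -> (forall i, L i != 0) ->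
  (forall p : R, 1 < p -> is_fundamental_solution L p (Gamma L p)) /\
  (forall x : 'rV[R]_(n + n + 1), x != 0 -> inf_laplacian L (rho L) x = 0).
Proof.
move=> n0 L0; split=> [p p1|x]; last exact: inf_laplacian_rho.
split.
- exact/elem_smooth/Gamma_elem.
- exact: Gamma_locally_integrable.
- by move=> phi tphi; exact: weak_equation.
Qed.
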